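(* Let $P$ be the transition kernel of a $\pi$-irreducible Markov chain that is reversible with respect to its invariant probability measure $\pi$. Assume that there exists an accessible atom $A$ such that $M:=\sup_{x\in X}\mathbb{E}_x[\sigma_A]<\infty$. Let $$\varrho=\sup\Bigl\{s<e^{1/M}:\ \sup_{x\in A}\sum_{n=1}^{\infty}s^{2n}F^{2n}(x,A)<1\Bigr\}.$$ Then for all $1<\lambda<e^{1/M}$ (and all $n$), $$\|P^n-\pi\|\le\begin{cases}F_1\varrho^{-n}+G_1\lambda^{-n},&\lambda\ne\varrho;\\ (J_1+K_1n)\varrho^{-n},&\lambda=\varrho,\end{cases}$$ where $$F_1=C_1\Bigl(1-\frac{\varrho-1}{\varrho-\lambda}M_1\Bigr),\qquad G_1=M_1\Bigl((2-C_1)^+\lambda^{-1}+\frac{\varrho-1}{\varrho-\lambda}C_1\Bigr),$$ $$J_1=C_1+(2-C_1)^+\varrho^{-1}M_1,\qquad K_1=C_1(1-\varrho^{-1})M_1,$$ $$C_1=\bigl(\pi(A)^{-1}-1\bigr)^{1/2},\qquad M_1=\lambda(1-M\log\lambda)^{-1}.$$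
   Context: $\Phi=\{\Phi_n:n\in\mathbb{Z}_+\}$ is a discrete-time homogeneous Markov chain on a general state space $X$ with countably generated $\sigma$-field $\mathscr{B}(X)$ and $n$-step transition kernel $P^n(x,B)=\mathbb{P}_x\{\Phi_n\in B\}$; $\mathbb{P}_x,\mathbb{E}_x$ are probability and expectation given $\Phi_0=x$. The chain has a (unique) invariant probability measure $\pi$ and is $\pi$-irreducible: if $\pi(B)>0$, there exists $n\in\mathbb{N}$ such that $P^n(x,B)>0$ for all $x\in X$. It is assumed that $P^n(x,\cdot)\ll\pi$ ($n\ge1$), with density $p^n(x,y)$. Reversible: $\pi(dx)P(x,dy)=\pi(dy)P(y,dx)$. A set $A\in\mathscr{B}(X)$ is an atom if there is a probability measure $\nu$ on $\mathscr{B}(X)$ with $P(x,B)=\nu(B)$ for all $x\in A$, $B\in\mathscr{B}(X)$; it is an accessible atom if moreover $\pi(A)>0$. $\sigma_A=\inf\{n\ge0:\Phi_n\in A\}$, $\tau_A=\inf\{n\ge1:\Phi_n\in A\}$, $F^n(x,A)=\mathbb{P}_x\{\tau_A=n\}$. $\|P^n-\pi\|=\sup_{x\in X}\|P^n(x,\cdot)-\pi\|_{\mathrm{Var}}$, where $\|\mu\|_{\mathrm{Var}}=\sup_{|f|\le1}|\mu(f)|$ for a signed measure $\mu$. $a^+=\max\{a,0\}$. In the definition of $\varrho$, $s$ ranges over non-negative reals. *)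

(* Defs.v *)
From HB Require Import structures.
From mathcomp Require Import all_boot all_order all_algebra.
From mathcomp Require Import all_classical all_reals all_analysis.

Set Implicit Arguments.
Unset Strict Implicit.
Unset Printing Implicit Defensive.

Import Order.TTheory GRing.Theory Num.Theory.
Import numFieldNormedType.Exports.

Local Open Scope classical_set_scope.
Local Open Scope ring_scope.
Local Open Scope ereal_scope.

Definition countably_generated d (X : measurableType d) : Prop :=
  exists G : set (set X), countable G /\ @measurable d X = <<s G >>.

(* [Phi] is realized on one measurable space [Omega]; [Pr x] is the law of the
   chain started at [x].  The Markov property is stated with respect to the
   natural filtration, in its integrated form
     Pr_x (E, Phi_{n+1} \in B) = E_x [1_E P(Phi_n, B)],
   for E in the sigma-algebra generated by Phi_0, ..., Phi_n. *)
Record markov_chain d dO (X : measurableType d) (Omega : measurableType dO)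
    (R : realType) (P : R.-pker X ~> X) (Pr : X -> probability Omega R)
    (Phi : nat -> {mfun Omega >-> X}) : Prop := MarkovChain {
  markov_chain_init : forall (x : X) (B : set X), measurable B ->
    Pr x (Phi 0%N @^-1` B) = \d_x B ;
  markov_chain_step : forall (x : X) (n : nat) (E : set Omega) (B : set X),
    g_sigma_preimage (fun k : 'I_n.+1 => Phi k : Omega -> X) E ->
    measurable B ->
    Pr x (E `&` Phi n.+1 @^-1` B) = \int[Pr x]_(w in E) P (Phi n w) B }.

Section Chain.
Context d dO (X : measurableType d) (Omega : measurableType dO) (R : realType).
Implicit Types (P : R.-pker X ~> X) (pi mu nu : probability X R) (A B : set X).
Implicit Types (Pr : X -> probability Omega R) (Phi : nat -> {mfun Omega >-> X}).

Definition nstep Pr Phi (n : nat) (x : X) : probability X R :=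
  distribution (Pr x) (Phi n).

Definition invariant P mu : Prop :=
  forall B, measurable B -> mu B = \int[mu]_x P x B.

Definition unique_invariant P pi : Prop :=
  invariant P pi /\
  forall mu, invariant P mu -> forall B, measurable B -> mu B = pi B.

Definition irreducible Pr Phi pi : Prop :=
  forall B, measurable B -> 0 < pi B ->
  forall x, exists2 n : nat, (0 < n)%N & 0 < nstep Pr Phi n x B.

(* pi(dx) P(x,dy) = pi(dy) P(y,dx), tested on measurable rectangles. *)
Definition reversible P pi : Prop :=
  forall B C, measurable B -> measurable C ->
  \int[pi]_(x in B) P x C = \int[pi]_(y in C) P y B.

Definition atom P A : Prop :=
  measurable A /\
  exists nu, forall x, A x -> forall B, measurable B -> P x B = nu B.

Definition accessible_atom P pi A : Prop := atom P A /\ 0 < pi A.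

(* sigma_A and tau_A are +oo on the trajectories that never visit A. *)
Definition sigma Phi A (w : Omega) : \bar R :=
  ereal_inf [set n%:R%:E | n in [set n : nat | A (Phi n w)]].

Definition tau Phi A (w : Omega) : \bar R :=
  ereal_inf [set n%:R%:E | n in [set n : nat | (1 <= n)%N /\ A (Phi n w)]].

Definition first_return Pr Phi (n : nat) (x : X) A : \bar R :=
  Pr x [set w | tau Phi A w = n%:R%:E].

(* ||mu - nu||_Var = sup_{|f| <= 1} |mu(f) - nu(f)|, f measurable; there is no
   factor 1/2, so the norm ranges over [0, 2]. *)
Definition var_norm mu nu : \bar R :=
  ereal_sup [set `| \int[mu]_y (f y)%:E - \int[nu]_y (f y)%:E | | f in
    [set f : X -> R | measurable_fun setT f /\ forall y, (`|f y| <= 1)%R]].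

Definition kernel_norm Pr Phi pi (n : nat) : \bar R :=
  ereal_sup [set var_norm (nstep Pr Phi n x) pi | x in [set: X]].

End Chain.

(* Main.v *)
(* Let C1 = ||1_A / pi(A) - 1|| in L2(pi) and t_k(x) = P_x(sigma_A >= k). A drift
   argument turns E_x sigma_A <= M into t_k(x) <= l^-k / (1 - M log l) for every
   1 < l < e^{1/M}. Decomposing P^n(x, .) at the first entrance into A and
   summing by parts reduces the theorem to ||P^m(a, .) - pi|| <= C1 rho^-m for
   a in A. By reversibility and Cauchy-Schwarz the left-hand side is at most
   e_m / pi(A), with e_m = ||P^m phi|| in L2(pi) and phi = 1_A - pi(A).

   The sequence v_n = <phi, P^n phi> has v_(2m) = e_m^2 and
   |v_(2m+1)| <= e_m e_(m+1), so (e_m) is log-convex, and it solves the renewal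
   equation sum_(k <= n) g_k v_(n-k) = O(l^-n), where g_k = P_a(tau_A > k). If
   e_m / e_(m+1) were to fall below some admissible s, it would decrease to a
   limit x < s, and the renewal equation divided by e_n^2 would give
   sum_i g_i (-x)^i <= 0. But (1 + x) sum_i g_i (-x)^i = 1 - sum_i (-x)^i f_i with
   f_i = P_a(tau_A = i), and this is positive as sum_i s^(2i) f_(2i) < 1. This
   replaces the spectral theorem and complex analysis. *)
Require Import Defs.
From HB Require Import structures.
From mathcomp Require Import all_boot all_order all_algebra.
From mathcomp Require Import all_classical all_reals all_analysis.
From mathcomp Require Import measurable_realfun.
From mathcomp Require Import ring lra zify.

Set Implicit Arguments.
Unset Strict Implicit.
Unset Printing Implicit Defensive.

Import Order.TTheory GRing.Theory Num.Theory.
Import numFieldNormedType.Exports.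

Local Open Scope classical_set_scope.
Local Open Scope ring_scope.
Local Open Scope ereal_scope.

(** * Bounded measurable functions *)

Section bounded_measurable.
Context d (T : measurableType d) (R : realType).
Implicit Types f g : T -> R.
Local Open Scope ring_scope.

(** One class of test functions, stable under algebra and under the kernel, on which integrals
    against probability measures are finite. *)
Definition bmf f := measurable_fun setT f /\ exists K : R, forall x, `|f x| <= K.

Lemma bmf_cst (c : R) : bmf (fun=> c).
Proof. by split; [exact: measurable_cst | exists `|c|]. Qed.

Lemma bmfD f g : bmf f -> bmf g -> bmf (fun x => f x + g x).
Proof.
move=> [mf [K fK]] [mg [L gL]]; split; first exact: measurable_funD.
by exists (K + L) => x; rewrite (le_trans (ler_normD _ _))// lerD.
Qed.

Lemma bmfM f g : bmf f -> bmf g -> bmf (fun x => f x * g x).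
Proof.
move=> [mf [K fK]] [mg [L gL]]; split; first exact: measurable_funM.
by exists (K * L) => x; rewrite normrM ler_pM.
Qed.

Lemma bmfZ (c : R) f : bmf f -> bmf (fun x => c * f x).
Proof. by move=> bf; apply: bmfM => //; exact: bmf_cst. Qed.

Lemma bmfB f g : bmf f -> bmf g -> bmf (fun x => f x - g x).
Proof.
move=> bf bg; have := bmfD bf (bmfZ (-1) bg).
by under [fun x => f x + _]eq_fun do rewrite mulN1r.
Qed.

Lemma bmf_sum n (F : 'I_n -> T -> R) : (forall i, bmf (F i)) ->
  bmf (fun x => \sum_(i < n) F i x).
Proof.
elim: n F => [|n IHn] F bF.
  by under eq_fun do rewrite big_ord0; exact: bmf_cst.
under eq_fun do rewrite big_ord_recr/=.
by apply: bmfD => //; exact: IHn.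
Qed.

Lemma bmf_indic (B : set T) : measurable B -> bmf (\1_B : T -> R).
Proof.
move=> mB; split; first exact: measurable_indic.
by exists 1 => x; rewrite indicE; case: (_ \in _); rewrite ?normr1 ?normr0.
Qed.

Lemma bmf_comp d' (U : measurableType d') (h : U -> T) f :
  measurable_fun setT h -> bmf f ->
  measurable_fun setT (f \o h) /\ exists K : R, forall x, `|f (h x)| <= K.
Proof.
by move=> mh [mf [K fK]]; split; [exact: measurableT_comp | exists K => x].
Qed.

(* Not [probability T R], because the values of a probability kernel are typed
   as mere measures. *)
Variable mu : {measure set T -> \bar R}.
Hypothesis mu1 : mu setT = 1%E.

Lemma bmf_integrable f : bmf f -> mu.-integrable setT (EFin \o f).
Proof.
move=> [mf [K fK]]; apply: measurable_bounded_integrable => //.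
  by rewrite [ltLHS]mu1 ltey.
exists K; split; first by rewrite num_real.
by move=> M KM x _ /=; rewrite (le_trans (fK x))// ltW.
Qed.

Lemma meanD f g : bmf f -> bmf g ->
  \int[mu]_x (f x + g x) = \int[mu]_x f x + \int[mu]_x g x.
Proof. by move=> bf bg; rewrite RintegralD//; exact: bmf_integrable. Qed.

Lemma meanB f g : bmf f -> bmf g ->
  \int[mu]_x (f x - g x) = \int[mu]_x f x - \int[mu]_x g x.
Proof. by move=> bf bg; rewrite RintegralB//; exact: bmf_integrable. Qed.

Lemma meanZ (c : R) f : bmf f -> \int[mu]_x (c * f x) = c * \int[mu]_x f x.
Proof. by move=> bf; rewrite RintegralZl//; exact: bmf_integrable. Qed.

Lemma mean_cst (c : R) : \int[mu]_x c = c.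
Proof. by rewrite Rintegral_cst// [X in fine X]mu1 mulr1. Qed.

Lemma le_mean f g : bmf f -> bmf g -> (forall x, f x <= g x) ->
  \int[mu]_x f x <= \int[mu]_x g x.
Proof. by move=> bf bg fg; apply: le_Rintegral => //; exact: bmf_integrable. Qed.

Lemma mean_norm_le f (K : R) : bmf f -> (forall x, `|f x| <= K) ->
  `|\int[mu]_x f x| <= K.
Proof.
move=> bf fK; have fKK x : - K <= f x <= K by rewrite -ler_norml.
rewrite ler_norml; apply/andP; split.
  rewrite -[leLHS]mean_cst; apply: le_mean => //; first exact: bmf_cst.
  by move=> x; have /andP[] := fKK x.
rewrite -[leRHS]mean_cst; apply: le_mean => //; first exact: bmf_cst.
by move=> x; have /andP[] := fKK x.
Qed.

Lemma mean_EFin f : bmf f -> (\int[mu]_x (f x)%:E)%E = (\int[mu]_x f x)%:E.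
Proof.
by move=> bf; rewrite /Rintegral fineK// integrable_fin_num//; exact: bmf_integrable.
Qed.

Lemma mean_indic (B : set T) : measurable B -> \int[mu]_x (\1_B x : R) = fine (mu B).
Proof. by move=> mB; rewrite /Rintegral integral_indic// setIT. Qed.

Lemma mean_sum n (F : 'I_n -> T -> R) : (forall i, bmf (F i)) ->
  \int[mu]_x (\sum_(i < n) F i x) = \sum_(i < n) \int[mu]_x F i x.
Proof.
elim: n F => [|n IHn] F bF.
  by rewrite big_ord0; under eq_Rintegral do rewrite big_ord0; exact: mean_cst.
rewrite big_ord_recr/= -IHn// -meanD//; last exact: bmf_sum.
by apply: eq_Rintegral => x _; rewrite big_ord_recr.
Qed.

End bounded_measurable.

(** * Extension of identities from indicators to bounded functions *)

Section functional_extension.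
Context d (T : measurableType d) (R : realType).
Implicit Types (f g : T -> R) (L : (T -> R) -> R).
Local Open Scope ring_scope.

(** Boundedness is for the sup norm, expressed through an arbitrary bound [K] on [f]. *)
Definition bounded_linear L :=
  [/\ forall f g, bmf f -> bmf g -> L (fun x => f x + g x) = L f + L g,
      forall c f, bmf f -> L (fun x => c * f x) = c * L f
    & exists C : R, forall f (K : R), bmf f -> (forall x, `|f x| <= K) -> `|L f| <= C * K].

Lemma bounded_linearB L1 L2 : bounded_linear L1 -> bounded_linear L2 ->
  bounded_linear (fun f => L1 f - L2 f).
Proof.
move=> [D1 Z1 [C1 B1]] [D2 Z2 [C2 B2]]; split.
- by move=> f g bf bg; rewrite D1// D2//; ring.
- by move=> c f bf; rewrite Z1// Z2//; ring.
- exists (C1 + C2) => f K bf fK; rewrite mulrDl (le_trans (ler_normB _ _))//.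
  by rewrite lerD ?B1 ?B2.
Qed.

(** The sum counts the integers from 1 to n that are at most y: it is the floor of y. *)
Lemma layer_sum_approx n (y : R) : 0 <= y <= n%:R ->
  \sum_(j < n) (j.+1%:R <= y)%R%:R <= y <= \sum_(j < n) (j.+1%:R <= y)%R%:R + 1.
Proof.
elim: n => [|n IHn].
  by rewrite big_ord0 add0r => /andP[-> y0]; rewrite (le_trans y0).
move=> /andP[y0 yn]; rewrite big_ord_recr/=.
have [yn'|yn'] := leP y n%:R.
  have [ny|_] := leP n.+1%:R y; last by rewrite addr0 IHn// y0.
  by have := le_trans ny yn'; rewrite ler_nat ltnn.
rewrite (eq_bigr (fun=> 1)); last first.
  by move=> j _; rewrite (le_trans _ (ltW yn'))// ler_nat.
rewrite sumr_const card_ord.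
have [ny|ny] := leP n.+1%:R y; first by rewrite natr1 ny (le_trans yn)// lerDl.
by rewrite addr0 (ltW yn')/= natr1.
Qed.

(* A bounded function with values in [0, 1] is within 1/n of the average of the
   indicators of its level sets {h >= j/n}, so a sup-norm bounded functional
   vanishing on indicators vanishes. *)
Lemma bounded_linear_eq0 L : bounded_linear L ->
  (forall B, measurable B -> L \1_B = 0) -> forall f, bmf f -> L f = 0.
Proof.
move=> [LD LZ [C LC]] L1 f bf; have [mf [K0 fK0]] := bf.
pose K : R := `|K0| + 1; have K_gt0 : 0 < K by rewrite ltr_wpDl.
have fK x : `|f x| <= K by rewrite (le_trans (fK0 x))// ler_wpDr// ler_norm.
pose h x : R := (2 * K)^-1 * (f x + K).
have bh : bmf h by apply: bmfZ; apply: bmfD => //; exact: bmf_cst.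
have h01 x : 0 <= h x <= 1.
  have := fK x; rewrite ler_norml => /andP[f1 f2]; rewrite /h; apply/andP; split.
    by rewrite mulr_ge0// ?invr_ge0 ?mulr_ge0 ?(ltW K_gt0)//; lra.
  by rewrite mulrC ler_pdivrMr ?mulr_gt0//; lra.
pose s n m x : R := \sum_(j < m) (j.+1%:R <= n%:R * h x)%R%:R.
have mlev n (j : R) : measurable [set x | j <= n%:R * h x].
  rewrite -[X in measurable X]setTI.
  have := (bmfZ n%:R bh).1 measurableT `[j, +oo[%classic (measurable_itv _).
  by congr (measurable (_ `&` _)); apply/seteqP; split => x /=; rewrite in_itv/= andbT.
have sE n m : s n m.+1 =
    (fun x => s n m x + \1_[set x | m.+1%:R <= n%:R * h x] x) :> (T -> R).
  apply/funext => x; rewrite /s big_ord_recr/= indicE; congr (_ + (nat_of_bool _)%:R).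
  by apply/idP/idP; rewrite inE.
have bs n m : bmf (s n m).
  elim: m => [|m IHm]; last by rewrite sE; apply: bmfD => //; exact: bmf_indic.
  rewrite (_ : s n 0%N = fun=> 0); first exact: bmf_cst.
  by apply/funext => x; rewrite /s big_ord0.
have Ls n m : L (s n m) = 0.
  elim: m => [|m IHm].
    (* Zero is written as a product so that homogeneity of [L] applies. *)
    rewrite (_ : s n 0%N = fun=> 0 * 0); first by rewrite LZ ?mul0r//; exact: bmf_cst.
    by apply/funext => x; rewrite /s big_ord0 mul0r.
  by rewrite sE LD ?IHm ?L1 ?addr0//; exact: bmf_indic.
have Lh n : n%:R * `|L h| <= C.
  have <- : `|L (fun x => n%:R * h x + (-1) * s n n x)| = n%:R * `|L h|.
    rewrite LD; [|exact: bmfZ..].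
    by rewrite (LZ _ _ bh) (LZ _ _ (bs n n)) Ls mulr0 addr0 normrM normr_nat.
  rewrite -[C]mulr1; apply: LC; first by apply: bmfD; exact: bmfZ.
  move=> x; have /andP[h0 h1] := h01 x.
  have /layer_sum_approx : 0 <= n%:R * h x <= n%:R by rewrite mulr_ge0//= ler_piMr.
  by rewrite -/(s n n x) ler_norml => /andP[? ?]; apply/andP; split; lra.
have Lh0 : L h = 0.
  apply/eqP/negPn/negP => Lh0.
  have := Lh (Num.bound (C / `|L h|)); rewrite leNgt => /negP; apply.
  rewrite -ltr_pdivrMr ?normr_gt0//; apply: archi_boundP.
  by rewrite divr_ge0// (le_trans _ (Lh 0%N))// mul0r.
have -> : f = (fun x => 2 * K * h x + - K * \1_setT x).
  apply/funext => x; rewrite /h indicE in_setT mulr1 mulrA mulfV ?mulf_neq0 ?gt_eqF//.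
  by rewrite mul1r addrK.
have b1 : bmf (\1_setT : T -> R) by exact: bmf_indic.
rewrite LD; [|exact: bmfZ..].
by rewrite (LZ _ _ bh) (LZ _ _ b1) Lh0 L1// !mulr0 addr0.
Qed.

Lemma bounded_linear_eq L1 L2 : bounded_linear L1 -> bounded_linear L2 ->
  (forall B, measurable B -> L1 \1_B = L2 \1_B) -> forall f, bmf f -> L1 f = L2 f.
Proof.
move=> b1 b2 E f bf; apply/eqP; rewrite -subr_eq0; apply/eqP.
apply: (bounded_linear_eq0 (bounded_linearB b1 b2)) => // B mB.
by rewrite E// subrr.
Qed.

End functional_extension.

(** * A probability kernel as an operator on bounded functions *)

Section kernel_operator.
Context d (X : measurableType d) (R : realType) (P : R.-pker X ~> X).
Implicit Types (f g : X -> R) (S : set X).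
Local Open Scope ring_scope.

Definition kop f (x : X) : R := \int[P x]_y f y.

Let P1 x : P x setT = 1%E. Proof. exact: prob_kernel. Qed.

Lemma kopD f g : bmf f -> bmf g ->
  kop (fun x => f x + g x) = (fun x => kop f x + kop g x).
Proof. by move=> bf bg; apply/funext => x; exact: meanD. Qed.

Lemma kopB f g : bmf f -> bmf g ->
  kop (fun x => f x - g x) = (fun x => kop f x - kop g x).
Proof. by move=> bf bg; apply/funext => x; exact: meanB. Qed.

Lemma kopZ (c : R) f : bmf f -> kop (fun x => c * f x) = (fun x => c * kop f x).
Proof. by move=> bf; apply/funext => x; exact: meanZ. Qed.

Lemma kop_cst (c : R) : kop (fun=> c) = (fun=> c).
Proof. by apply/funext => x; exact: mean_cst. Qed.

Lemma kop_indic S x : measurable S -> (kop \1_S x)%:E = P x S.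
Proof.
by move=> mS; rewrite -mean_EFin//; [rewrite integral_indic// setIT | exact: bmf_indic].
Qed.

Lemma le_kop f g x : bmf f -> bmf g -> (forall y, f y <= g y) -> kop f x <= kop g x.
Proof. exact: le_mean. Qed.

Lemma kop_norm_le f (K : R) x : bmf f -> (forall y, `|f y| <= K) -> `|kop f x| <= K.
Proof. exact: mean_norm_le. Qed.

(** Kernel integrals of non-negative functions are measurable, so [f] is shifted up by its bound and
    the shift is subtracted afterwards. *)
Lemma bmf_kop f : bmf f -> bmf (kop f).
Proof.
move=> bf; have [mf [K fK]] := bf; split; last by exists K => x; exact: kop_norm_le.
have bfK : bmf (fun x => f x + K) by apply: bmfD => //; exact: bmf_cst.
have -> : kop f = (fun x => fine (\int[P x]_y (f y + K)%:E) - K).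
  apply/funext => x; rewrite -[X in _ = X - _]/(kop (fun y => f y + K) x).
  by rewrite kopD//; [rewrite kop_cst addrK | exact: bmf_cst].
apply: measurable_funB => //.
apply: (measurableT_comp (@fine_measurable R setT measurableT)).
apply: (@measurable_fun_integral_kernel _ _ _ _ _ P).
- by move=> U mU; exact: measurable_kernel.
- by move=> z; rewrite lee_fin -lerBlDr sub0r; have := fK z; rewrite ler_norml => /andP[].
- by apply/measurable_EFinP; exact: bfK.1.
Qed.

(** The restriction bears on the point that is left, not on the point that is reached. *)
Definition ktaboo S f (x : X) : R := \1_S x * kop f x.

Lemma bmf_ktaboo S f : measurable S -> bmf f -> bmf (ktaboo S f).
Proof. by move=> mS bf; apply: bmfM; [exact: bmf_indic | exact: bmf_kop]. Qed.

End kernel_operator.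

Section mean_restriction.
Context d (T : measurableType d) (R : realType).
Local Open Scope ring_scope.

Lemma mean_indicM (mu : {measure set T -> \bar R}) (D : set T) (f : T -> R) :
  \int[mu]_x (\1_D x * f x) = fine (\int[mu]_(x in D) (f x)%:E)%E.
Proof.
rewrite -[RHS]/(Rintegral mu D f) [RHS]Rintegral_mkcond; apply: eq_Rintegral => x _.
by rewrite patchE indicE; case: (x \in D); rewrite ?mul1r ?mul0r.
Qed.

End mean_restriction.

(** * The kernel as a symmetric operator for pi *)

Section reversibility.
Context d (X : measurableType d) (R : realType) (P : R.-pker X ~> X).
Variable pi : probability X R.
Implicit Types f g : X -> R.
Hypothesis rev : reversible P pi.
Local Open Scope ring_scope.

Let pi1 : pi setT = 1%E := probability_setT pi.

Lemma bounded_linear_meanM (h : X -> R) : bmf h ->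
  bounded_linear (fun f => \int[pi]_x (h x * f x)).
Proof.
move=> bh; have [_ [C hC]] := bh; split.
- move=> f g bf bg; rewrite -meanD//; [|exact: bmfM..].
  by apply: eq_Rintegral => x _; rewrite mulrDr.
- move=> c f bf; rewrite -meanZ//; [|exact: bmfM..].
  by apply: eq_Rintegral => x _; rewrite mulrCA.
- exists C => f K bf fK; apply: mean_norm_le => //; first exact: bmfM.
  by move=> x; rewrite normrM ler_pM.
Qed.

Lemma bounded_linear_comp_kop (L : (X -> R) -> R) :
  bounded_linear L -> bounded_linear (fun f => L (kop P f)).
Proof.
move=> [LD LZ [C LC]]; split.
- by move=> f g bf bg; rewrite kopD// LD//; exact: bmf_kop.
- by move=> c f bf; rewrite kopZ// LZ//; exact: bmf_kop.
- exists C => f K bf fK; apply: LC => //; first exact: bmf_kop.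
  by move=> x; exact: kop_norm_le.
Qed.

(** For two indicators this is reversibility. Both sides are bounded linear in each argument, so it
    extends first in [g], then in [f]. *)
Lemma kop_symmetric f g : bmf f -> bmf g ->
  \int[pi]_x (f x * kop P g x) = \int[pi]_x (g x * kop P f x).
Proof.
move=> bf bg.
pose L1 (f : X -> R) (g : X -> R) := \int[pi]_x (f x * kop P g x).
have bL1 f' : bmf f' -> bounded_linear (L1 f').
  by move=> bf'; exact: (bounded_linear_comp_kop (bounded_linear_meanM bf')).
have bL2 f' : bmf f' -> bounded_linear (L1 ^~ f').
  move=> bf'; have := bounded_linear_meanM (bmf_kop P bf').
  rewrite (_ : (fun _ => _) = L1 ^~ f')//; apply/funext => h.
  by apply: eq_Rintegral => x _; rewrite mulrC.
apply: (@bounded_linear_eq _ _ _ (L1 f) (L1 ^~ f)); [exact: bL1|exact: bL2| |by []].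
move=> C mC.
have bC : bmf (\1_C : X -> R) by exact: bmf_indic.
apply: (@bounded_linear_eq _ _ _ (L1 ^~ \1_C) (L1 \1_C)); [exact: bL2|exact: bL1| |by []].
move=> B mB; rewrite /L1 !mean_indicM; congr fine.
transitivity (\int[pi]_(x in B) P x C)%E; last rewrite rev//.
  by apply: eq_integral => x _; rewrite kop_indic.
by apply: eq_integral => x _; rewrite kop_indic.
Qed.

(** Symmetry against the constant 1: reversibility makes pi invariant. *)
Lemma mean_kop f : bmf f -> \int[pi]_x kop P f x = \int[pi]_x f x.
Proof.
move=> bf; have := kop_symmetric (bmf_cst X (1 : R)) bf.
rewrite kop_cst; under eq_Rintegral do rewrite mul1r.
by move=> ->; apply: eq_Rintegral => x _; rewrite mulr1.
Qed.

End reversibility.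

(** * Taboo probabilities and hitting times *)

Section taboo_paths.
Context d dO (X : measurableType d) (Omega : measurableType dO) (R : realType).
Variables (P : R.-pker X ~> X) (Pr : X -> probability Omega R).
Variable Phi : nat -> {mfun Omega >-> X}.
Hypothesis chain : markov_chain P Pr Phi.
Implicit Types (S : nat -> set X) (f : X -> R).
Local Open Scope ring_scope.

(** The sets depend on time so that the return time to A can leave time 0 unconstrained. *)
Definition stay S n : set Omega := [set w | forall i, (i < n)%N -> S i (Phi i w)].

(** This is Q_0 (Q_1 (... (Q_(n-1) f))) with Q_i = [ktaboo P (S i)]. The recursion removes the last
    step, as the Markov property does. *)
Fixpoint taboo_seq S n f : X -> R :=
  if n is m.+1 then taboo_seq S m (ktaboo P (S m) f) else f.

Lemma staySr S n : stay S n.+1 = stay S n `&` Phi n @^-1` S n.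
Proof.
apply/seteqP; split => w /= => [Sw|[Sw Snw] i].
  by split=> [i ni|]; apply: Sw => //; exact: ltnW.
by rewrite ltnS leq_eqVlt => /predU1P[->//|]; exact: Sw.
Qed.

Lemma stay0 S : stay S 0 = setT.
Proof. by apply/seteqP; split => w. Qed.

(** The event is the complement of a countable union of history events, padded with empty sets after
    time n. *)
Lemma stay_history S n : (forall i, measurable (S i)) ->
  g_sigma_preimage (fun k : 'I_n.+1 => Phi k : Omega -> X) (stay S n.+1).
Proof.
move=> mS; rewrite /g_sigma_preimage; set G := (X in <<s X >>).
have [G0 GC GU] : sigma_algebra setT <<s G >> := smallest_sigma_algebra setT G.
pose B k := if (k < n.+1)%N then setT `\` Phi k @^-1` S k else set0.
have -> : stay S n.+1 = setT `\` \bigcup_k B k.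
  apply/seteqP; split => w /=.
    move=> Sw; split => // -[k _]; rewrite /B; case: ifPn => // kn [_]; apply.
    exact: Sw.
  move=> [_ Bw] i ni; apply: contrapT => Siw; apply: Bw; exists i => //.
  by rewrite /B ni.
apply: (GC); apply: GU => k; rewrite /B; case: ifPn => // kn; apply: (GC).
apply: sub_sigma_algebra; rewrite /G (bigD1 (Ordinal kn))//=; left.
by exists (S k) => //; rewrite setTI.
Qed.

Lemma measurable_stay S n : (forall i, measurable (S i)) -> measurable (stay S n).
Proof.
move=> mS; elim: n => [|n IHn]; first by rewrite stay0.
by rewrite staySr; apply: measurableI => //; exact: measurable_funPTI.
Qed.

Lemma bmf_path n f : bmf f -> bmf (fun w => f (Phi n w)).
Proof. by move=> bf; apply: (bmf_comp (h := Phi n)). Qed.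

Lemma mean_initial x f : bmf f -> \int[Pr x]_w f (Phi 0%N w) = f x.
Proof.
pose ev f : R := \int[Pr x]_w f (Phi 0%N w).
apply: (@bounded_linear_eq _ _ _ ev (@^~ x)).
- split.
  + by move=> g h bg bh; rewrite /ev meanD//; [exact: probability_setT|exact: bmf_path..].
  + by move=> c g bg; rewrite /ev meanZ//; [exact: probability_setT|exact: bmf_path].
  + exists 1 => g K bg gK; rewrite mul1r; apply: mean_norm_le => //.
      exact: probability_setT.
    exact: bmf_path.
- by split=> //; exists 1 => g K _ gK; rewrite mul1r.
- move=> B mB; rewrite /ev (_ : (fun w => _) = \1_(Phi 0%N @^-1` B))//.
  rewrite mean_indic; last exact: measurable_funPTI.
  by rewrite [X in fine X](markov_chain_init chain)// diracE indicE.
Qed.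

(** For an indicator this is the integrated Markov property on an event of the history up to time n;
    the rest is extension. *)
Lemma mean_step S x n f : (forall i, measurable (S i)) -> bmf f ->
  \int[Pr x]_w (\1_(stay S n.+1) w * f (Phi n.+1 w)) =
  \int[Pr x]_w (\1_(stay S n.+1) w * kop P f (Phi n w)).
Proof.
move=> mS.
have b1 : bmf (\1_(stay S n.+1) : Omega -> R).
  by apply: bmf_indic; exact: measurable_stay.
pose ev m f : R := \int[Pr x]_w (\1_(stay S n.+1) w * f (Phi m w)).
have blev m : bounded_linear (ev m).
  have PrT : Pr x setT = 1%E by exact: probability_setT.
  split.
  - move=> g h bg bh; rewrite /ev -meanD//; [|apply: bmfM => //; exact: bmf_path..].
    by apply: eq_Rintegral => w _; rewrite mulrDr.
  - move=> c g bg; rewrite /ev -meanZ//; [|apply: bmfM => //; exact: bmf_path].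
    by apply: eq_Rintegral => w _; rewrite mulrCA.
  - exists 1 => g K bg gK; rewrite mul1r; apply: mean_norm_le => //.
      by apply: bmfM => //; exact: bmf_path.
    move=> w; rewrite indicE normrM; case: (_ \in _); rewrite ?normr1 ?mul1r//.
    by rewrite normr0 mul0r (le_trans _ (gK (Phi m w))).
apply: (@bounded_linear_eq _ _ _ (ev n.+1) (fun g => ev n (kop P g))).
- exact: blev.
- exact: bounded_linear_comp_kop.
- move=> B mB.
  transitivity (\int[Pr x]_w \1_(stay S n.+1 `&` Phi n.+1 @^-1` B) w : R).
    by apply: eq_Rintegral => w _; rewrite indicI.
  rewrite mean_indic; last first.
    by apply: measurableI; [exact: measurable_stay | exact: measurable_funPTI].
  rewrite [X in fine X](markov_chain_step chain x (stay_history (n := n) mS) mB).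
  rewrite /ev mean_indicM; congr fine.
  by apply: eq_integral => w _; rewrite kop_indic.
Qed.

(** Once the last step is replaced by the kernel, the constraint at the time before it is absorbed
    into the test function. *)
Lemma mean_stay S x n f : (forall i, measurable (S i)) -> bmf f ->
  \int[Pr x]_w (\1_(stay S n) w * f (Phi n w)) = taboo_seq S n f x.
Proof.
move=> mS; elim: n f => [|n IHn] f bf.
  rewrite stay0 -[RHS](mean_initial x bf).
  by apply: eq_Rintegral => w _; rewrite indicE in_setT mul1r.
rewrite mean_step//= -IHn; last exact: bmf_ktaboo.
by apply: eq_Rintegral => w _; rewrite staySr indicI/= /ktaboo mulrA.
Qed.

End taboo_paths.

Section hitting_times.
Context d dO (X : measurableType d) (Omega : measurableType dO) (R : realType).
Variables (P : R.-pker X ~> X) (Pr : X -> probability Omega R).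
Variable Phi : nat -> {mfun Omega >-> X}.
Hypothesis chain : markov_chain P Pr Phi.
Variable A : set X.
Hypothesis mA : measurable A.
Implicit Types f : X -> R.
Local Open Scope ring_scope.

(* [tail k x] is the probability, starting from [x], that sigma_A >= k. *)
Definition tail k : X -> R := iter k (ktaboo P (~` A)) (fun=> 1).

Let mAC : measurable (~` A). Proof. exact: measurableC. Qed.

Lemma bmf_iter_ktaboo S f n : measurable S -> bmf f -> bmf (iter n (ktaboo P S) f).
Proof. by move=> mS bf; elim: n => //= n IHn; exact: bmf_ktaboo. Qed.

Lemma taboo_seq_cst S n f : taboo_seq P (fun=> S) n f = iter n (ktaboo P S) f.
Proof. by elim: n f => //= n IHn f; rewrite IHn -iterSr. Qed.

Lemma ktabooT : ktaboo P setT = kop P.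
Proof. by apply/funext => f; apply/funext => x; rewrite /ktaboo indicE in_setT mul1r. Qed.

Lemma mean_nstep x n f : bmf f ->
  \int[nstep Pr Phi n x]_y f y = iter n (kop P) f x.
Proof.
move=> bf; rewrite -ktabooT -taboo_seq_cst -(mean_stay chain)//.
have -> : stay Phi (fun=> setT) n = setT by apply/seteqP; split => w.
rewrite /Rintegral integral_distribution.
- by apply: eq_Rintegral => w _; rewrite indicE in_setT mul1r.
- by apply/measurable_EFinP; exact: bf.1.
- by apply: (@bmf_integrable _ _ _ (Pr x) (probability_setT _) _ (bmf_path Phi n bf)).
Qed.

Lemma mean_stay_setC x k : \int[Pr x]_w \1_(stay Phi (fun=> ~` A) k) w = tail k x.
Proof.
rewrite /tail -taboo_seq_cst -(mean_stay chain)//; last exact: bmf_cst.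
by apply: eq_Rintegral => w _; rewrite mulr1.
Qed.

(* Unlike in [ge0_le_integral], neither function has to be measurable; the bound
   is applied to [sigma]. *)
Lemma ge0_le_integral_nonmeasurable (mu : {measure set Omega -> \bar R})
    (f g : Omega -> \bar R) : (forall w, 0 <= f w)%E -> (forall w, f w <= g w)%E ->
  (\int[mu]_w f w <= \int[mu]_w g w)%E.
Proof.
move=> f0 fg; rewrite !ge0_integralTE//; last by move=> w; rewrite (le_trans (f0 w)).
apply: ereal_sup_le => _ [h hf <-]; exists h => // w.
by rewrite (le_trans (hf w)).
Qed.

(** If A is visited at time n, the path can avoid A through time k only for k < n, so at most min(N,
    n) indicators are 1. *)
Lemma sum_stay_le_sigma N w :
  ((\sum_(k < N) \1_(stay Phi (fun=> ~` A) k.+1) w)%:E <= sigma R Phi A w)%E.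
Proof.
apply: le_ereal_inf_tmp => _ [n /= An <-]; rewrite lee_fin.
apply: (@le_trans _ _ (\sum_(k < N) (k < n)%:R)).
  apply: ler_sum => k _; rewrite indicE.
  have [//|nk] := ltnP k n; first by case: (_ \in _).
  by rewrite memNset//= => /(_ n); rewrite ltnS => /(_ nk).
have -> : \sum_(k < N) (k < n)%:R = (minn N n)%:R :> R.
  elim: N => [|N IHN]; first by rewrite big_ord0 min0n.
  by rewrite big_ord_recr/= IHN -natrD; congr _%:R; lia.
by rewrite ler_nat geq_minr.
Qed.

(** One half of E sigma = sum_k P(sigma > k), in partial sums. The assumption on M enters through
    it. *)
Lemma sum_tail_le_mean_sigma N x :
  ((\sum_(k < N) tail k.+1 x)%:E <= \int[Pr x]_w sigma R Phi A w)%E.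
Proof.
have bS k : bmf (\1_(stay Phi (fun=> ~` A) k) : Omega -> R).
  by apply: bmf_indic; exact: measurable_stay.
under eq_bigr do rewrite -mean_stay_setC.
rewrite -mean_sum//; last exact: probability_setT.
rewrite -mean_EFin; [|exact: probability_setT|exact: bmf_sum].
apply: ge0_le_integral_nonmeasurable => w; last exact: sum_stay_le_sigma.
by rewrite lee_fin sumr_ge0.
Qed.

Lemma tau_eqE m : [set w | tau R Phi A w = m.+1%:R%:E] =
  stay Phi (fun i => if i == 0%N then setT else ~` A) m.+1 `&` Phi m.+1 @^-1` A.
Proof.
apply/seteqP; split => w /=.
  move=> tauE.
  have tau_le i : (1 <= i)%N -> A (Phi i w) -> (m.+1 <= i)%N.
    move=> i1 Ai; rewrite -(ler_nat R) -lee_fin -tauE.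
    by apply: ereal_inf_lbound; exists i.
  split=> [i im|]; first by case: i im => //= i im /(tau_le i.+1); lia.
  (* The infimum is attained: otherwise every visit would occur at time m + 2 or later. *)
  apply: contrapT => Am.
  have : (m.+2%:R%:E <= tau R Phi A w)%E.
    apply: le_ereal_inf_tmp => _ [i /= [i1 Ai] <-].
    rewrite lee_fin ler_nat ltn_neqAle tau_le// andbT.
    by apply/eqP => mi; apply: Am; rewrite mi.
  by rewrite tauE lee_fin ler_nat ltnn.
move=> [Sw Aw]; apply/eqP; rewrite eq_le; apply/andP; split.
  by apply: ereal_inf_lbound; exists m.+1.
apply: le_ereal_inf_tmp => _ [i /= [i1 Ai] <-]; rewrite lee_fin ler_nat leqNgt.
by apply/negP => im; have := Sw _ im; case: i i1 {im} Ai.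
Qed.

(** Time 0 is free, so the outermost kernel is unrestricted; the m later steps leave from the
    complement of A. *)
Lemma first_returnE m x : first_return Pr Phi m.+1 x A =
  (kop P (iter m (ktaboo P (~` A)) \1_A) x)%:E.
Proof.
pose S i := if i == 0%N then setT else ~` A.
have mS i : measurable (S i) by rewrite /S; case: ifP.
have bA : bmf (\1_A : X -> R) by exact: bmf_indic.
have tabooE k f : taboo_seq P S k.+1 f = kop P (iter k (ktaboo P (~` A)) f).
  elim: k f => [|k IHk] f; first by rewrite /= ktabooT.
  by rewrite -[LHS]/(taboo_seq P S k.+1 (ktaboo P (~` A) f)) IHk -iterSr.
rewrite -tabooE -(mean_stay chain)// /first_return tau_eqE.
have mE : measurable (stay Phi S m.+1 `&` Phi m.+1 @^-1` A).
  by apply: measurableI; [exact: measurable_stay | exact: measurable_funPTI].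
rewrite -[LHS]fineK; last exact: fin_num_measure.
congr EFin; rewrite -[LHS](mean_indic (Pr x))//.
by apply: eq_Rintegral => w _; rewrite indicI.
Qed.

End hitting_times.

(** * Tails of the entrance time into A *)

Section tail.
Context d (X : measurableType d) (R : realType) (P : R.-pker X ~> X).
Variable A : set X.
Hypothesis mA : measurable A.
Implicit Types f : X -> R.
Local Open Scope ring_scope.
Local Notation Q := (ktaboo P (~` A)).
Local Notation t := (tail P A).

Let mAC : measurable (~` A). Proof. exact: measurableC. Qed.

Lemma ktabooD f g : bmf f -> bmf g -> Q (fun x => f x + g x) = (fun x => Q f x + Q g x).
Proof. by move=> bf bg; apply/funext => x; rewrite /ktaboo kopD// mulrDr. Qed.

Lemma ktabooB f g : bmf f -> bmf g -> Q (fun x => f x - g x) = (fun x => Q f x - Q g x).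
Proof. by move=> bf bg; apply/funext => x; rewrite /ktaboo kopB// mulrBr. Qed.

Lemma ktabooZ (c : R) f : bmf f -> Q (fun x => c * f x) = (fun x => c * Q f x).
Proof. by move=> bf; apply/funext => x; rewrite /ktaboo kopZ// mulrCA. Qed.

Lemma ktaboo_sum n (F : 'I_n -> X -> R) : (forall i, bmf (F i)) ->
  Q (fun x => \sum_(i < n) F i x) = (fun x => \sum_(i < n) Q (F i) x).
Proof.
move=> bF; apply/funext => x; rewrite /ktaboo -mulr_sumr; congr (_ * _).
by apply: mean_sum => //; exact: prob_kernel.
Qed.

Lemma le_ktaboo f g x : bmf f -> bmf g -> (forall y, f y <= g y) -> Q f x <= Q g x.
Proof. by move=> bf bg fg; rewrite /ktaboo ler_wpM2l ?indicE//; exact: le_kop. Qed.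

Lemma bmf_tail k : bmf (t k).
Proof. by apply: bmf_iter_ktaboo => //; exact: bmf_cst. Qed.

Lemma tail_ge0 k x : 0 <= t k x.
Proof.
elim: k x => [|k IHk] x; first exact: ler01.
by rewrite /= mulr_ge0 ?indicE// /kop Rintegral_ge0.
Qed.

Lemma tailS_le k x : t k.+1 x <= t k x.
Proof.
elim: k x => [|k IHk] x; last exact: le_ktaboo (bmf_tail k.+1) (bmf_tail k) IHk.
by rewrite /= /ktaboo kop_cst mulr1 indicE lern1 leq_b1.
Qed.

Lemma tail_le1 k x : t k x <= 1.
Proof. by elim: k => // k; exact/le_trans/tailS_le. Qed.

Lemma tailS_atom k x : A x -> t k.+1 x = 0.
Proof. by move=> Ax; rewrite /= /ktaboo indicE memNset ?mul0r//; exact. Qed.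

(** Both sides are P_x(sigma_A = k). At k = 0 this is 1_A = 1 - 1_(~A), and [Q] is linear. *)
Lemma iter_ktaboo_indic k : iter k Q \1_A = (fun x => t k x - t k.+1 x).
Proof.
elim: k => [|k IHk].
  apply/funext => x; rewrite /= /ktaboo kop_cst mulr1 !indicE in_setC.
  by case: (x \in A); rewrite /= ?subr0 ?subrr.
by rewrite iterS IHk ktabooB//; exact: bmf_tail.
Qed.

(** [Q] is positive and [t n] is the n-th iterate of 1, so -K <= f <= K can be iterated. *)
Lemma iter_ktaboo_norm_le n f (K : R) x : bmf f -> (forall y, `|f y| <= K) ->
  `|iter n Q f x| <= K * t n x.
Proof.
move=> bf fK; have bt k : bmf (fun x => K * t k x) by apply: bmfZ; exact: bmf_tail.
have : forall y, - (K * t n y) <= iter n Q f y <= K * t n y.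
  elim: n => [y|n IHn y]; first by rewrite mulr1 -ler_norml.
  have -> : K * t n.+1 y = Q (fun y => K * t n y) y by rewrite ktabooZ//; exact: bmf_tail.
  have -> : - Q (fun y => K * t n y) y = Q (fun y => - 1 * (K * t n y)) y.
    by rewrite (ktabooZ (-1) (bt n)) mulN1r.
  apply/andP; split; apply: le_ktaboo => //; try exact: bmf_iter_ktaboo.
  - exact: bmfZ.
  - by move=> z; have /andP[] := IHn z; rewrite mulN1r.
  - by move=> z; have /andP[] := IHn z.
by rewrite ler_norml.
Qed.

(* With m(x) = E_x sigma_A, the function V = 1 + c m with c = ln l / (1 - M ln l)
   satisfies l Q V <= V; the partial sums of m are used so that every function
   stays bounded without a limit. *)
Lemma tail_geometric (M l : R) : 1 < l -> M * ln l < 1 ->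
  (forall N x, \sum_(k < N) t k.+1 x <= M) ->
  forall n x, t n x <= (1 - M * ln l)^-1 * l ^- n.
Proof.
move=> l1 ML1 sumM; have l0 : 0 < l by lra.
set L := ln l; have L0 : 0 < L by rewrite ln_gt0.
have Ml : 0 < 1 - M * L by rewrite subr_gt0.
(* This is ln (1 + u) <= u at u = 1/l - 1. *)
have lL : l - 1 <= l * L.
  have : ln (1 + (l^-1 - 1)) <= l^-1 - 1 by rewrite le_ln1Dx// ltrBDl addrN invr_gt0.
  rewrite addrCA subrr addr0 lnV// -/L lerNl opprB => lL.
  by rewrite -(ler_pM2l l0) mulrBr mulr1 divff ?gt_eqF in lL.
pose c := L / (1 - M * L).
have c0 : 0 <= c by rewrite divr_ge0// ltW.
have cE : 1 + c * M = (1 - M * L)^-1 by rewrite /c; field; rewrite gt_eqF.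
have V n x : l ^+ n * t n x <= 1 + c * \sum_(k < n) t k.+1 x.
  elim: n x => [|n IHn] x; first by rewrite big_ord0 expr0 mulr0 addr0 mul1r.
  have bs m : bmf (fun x => \sum_(k < m) t k.+1 x).
    by apply: bmf_sum => k; exact: bmf_tail.
  have Vx : l * (l ^+ n * t n.+1 x) <=
      l * (t 1%N x + c * (\sum_(k < n.+1) t k.+1 x - t 1%N x)).
    rewrite ler_pM2l//.
    have -> : l ^+ n * t n.+1 x = Q (fun y => l ^+ n * t n y) x.
      by rewrite ktabooZ//; exact: bmf_tail.
    have -> : t 1%N x + c * (\sum_(k < n.+1) t k.+1 x - t 1%N x) =
        Q (fun y => 1 + c * \sum_(k < n) t k.+1 y) x.
      rewrite ktabooD ?ktabooZ//; [|exact: bmf_cst|exact: bmfZ].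
      congr (_ + c * _); rewrite big_ord_recl addrC addKr.
      rewrite ktaboo_sum => [|k]; last exact: bmf_tail.
      by apply: eq_bigr => k _; rewrite lift0.
    apply: le_ktaboo => //; first by apply: bmfZ; exact: bmf_tail.
    by apply: bmfD; [exact: bmf_cst | exact: bmfZ].
  rewrite exprS -mulrA (le_trans Vx)//.
  have [xA|xA] := boolP (x \in A).
    have sx : \sum_(k < n.+1) t k.+1 x = 0.
      by rewrite big1// => k _; rewrite tailS_atom//; exact/set_mem.
    by rewrite sx (tailS_atom 0 (set_mem xA)) subr0 !(mulr0, addr0) ler01.
  have -> : t 1%N x = 1.
    by rewrite /= /ktaboo kop_cst mulr1 indicE in_setC xA.
  have := sumM n.+1 x; set s := \sum_(k < n.+1) _ => sM.
  (* The choice of c serves here: (l - 1) (1 + c M) = (l - 1) / (1 - M L) <= l L / (1 - M L) = l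
     c. *)
  have H1 : (l - 1) * (1 + c * s) <= l * c.
    apply: (@le_trans _ _ ((l - 1) * (1 + c * M))).
      by rewrite ler_pM2l ?subr_gt0// lerD2l ler_wpM2l.
    by rewrite cE /c mulrA ler_pM2r ?invr_gt0.
  rewrite -subr_ge0.
  have -> : 1 + c * s - l * (1 + c * (s - 1)) = l * c - (l - 1) * (1 + c * s) by ring.
  by rewrite subr_ge0.
move=> n x; rewrite ler_pdivlMr ?exprn_gt0// mulrC (le_trans (V n x))// -cE.
by rewrite lerD2l ler_wpM2l.
Qed.

End tail.

(** * Decay of the L2 norm of the centred indicator of the atom *)

Section second_moments.
Context d (X : measurableType d) (R : realType) (P : R.-pker X ~> X).
Variable pi : probability X R.
Hypothesis rev : reversible P pi.
Implicit Types f g : X -> R.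
Local Open Scope ring_scope.
Local Notation Pn n f := (iter n (kop P) f).

Let pi1 : pi setT = 1%E := probability_setT pi.

Definition dot f g : R := \int[pi]_x (f x * g x).
Definition norm2 f : R := Num.sqrt (dot f f).

Lemma bmf_iter_kop n f : bmf f -> bmf (Pn n f).
Proof. by move=> bf; elim: n => //= n IHn; exact: bmf_kop. Qed.

Lemma dotC f g : dot f g = dot g f.
Proof. by apply: eq_Rintegral => x _; rewrite mulrC. Qed.

Lemma dot_ge0 f : 0 <= dot f f.
Proof. by apply: Rintegral_ge0 => x _; rewrite -expr2 sqr_ge0. Qed.

Lemma sqr_norm2 f : norm2 f ^+ 2 = dot f f.
Proof. by rewrite sqr_sqrtr ?dot_ge0. Qed.

Lemma norm2_ge0 f : 0 <= norm2 f. Proof. exact: sqrtr_ge0. Qed.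

Lemma dot_comb (a b : R) f g : bmf f -> bmf g ->
  dot (fun x => a * f x + b * g x) (fun x => a * f x + b * g x) =
  a ^+ 2 * dot f f + 2 * a * b * dot f g + b ^+ 2 * dot g g.
Proof.
move=> bf bg; rewrite /dot -!meanZ//; [|exact: bmfM..].
rewrite -!meanD//; [|by do ?apply: bmfD; apply: bmfZ; exact: bmfM..].
by apply: eq_Rintegral => x _; ring.
Qed.

(** The square norm of -<h,k> h + <h,h> k is <h,h> times the difference of the two sides. If both
    functions are null, -<f,g> f + g has square norm -2 <f,g>^2, so <f,g> = 0. *)
Lemma dot_le_norm2 f g : bmf f -> bmf g -> `|dot f g| <= norm2 f * norm2 g.
Proof.
move=> bf bg; rewrite -(@ler_pXn2r _ 2)// ?nnegrE ?mulr_ge0 ?norm2_ge0//.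
rewrite exprMn !sqr_norm2 real_normK ?num_real//.
have pos (h k : X -> R) : bmf h -> bmf k -> 0 < dot h h ->
    dot h k ^+ 2 <= dot h h * dot k k.
  move=> bh bk h0; have := dot_ge0 (fun x => - dot h k * h x + dot h h * k x).
  rewrite dot_comb// -(pmulr_rge0 _ h0) => H; rewrite -subr_ge0.
  rewrite -(pmulr_rge0 _ h0) -(pmulr_rge0 _ h0); move: H; congr (_ <= _ * _); ring.
have [f0|f0] := ltP 0 (dot f f); first exact: pos.
have [g0|g0] := ltP 0 (dot g g); first by rewrite dotC mulrC; exact: pos.
have {}f0 : dot f f = 0 by apply/eqP; rewrite eq_le f0 dot_ge0.
have {}g0 : dot g g = 0 by apply/eqP; rewrite eq_le g0 dot_ge0.
have := dot_ge0 (fun x => - dot f g * f x + 1 * g x).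
rewrite dot_comb// f0 g0 => H.
rewrite mul0r -oppr_ge0 -(@pmulr_rge0 _ 2)//; move: H; congr (_ <= _); ring.
Qed.

Lemma dot_kop f g : bmf f -> bmf g -> dot (kop P f) g = dot f (kop P g).
Proof. by move=> bf bg; rewrite dotC /dot kop_symmetric. Qed.

Lemma dot_iter_kop n f g : bmf f -> bmf g -> dot (Pn n f) g = dot f (Pn n g).
Proof.
move=> bf; elim: n g => // n IHn g bg.
rewrite [in RHS]iterSr -IHn; last exact: bmf_kop.
by rewrite iterS dot_kop//; exact: bmf_iter_kop.
Qed.

Lemma dot_iter_kopD m n f : bmf f -> dot (Pn m f) (Pn n f) = dot f (Pn (m + n) f).
Proof. by move=> bf; rewrite dot_iter_kop -?iterD//; exact: bmf_iter_kop. Qed.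

Lemma mean_iter_kop n f : bmf f -> \int[pi]_x Pn n f x = \int[pi]_x f x.
Proof.
by move=> bf; elim: n => //= n IHn; rewrite mean_kop//; exact: bmf_iter_kop.
Qed.

(** The variance of f under P(x, .) is non-negative, hence (P f)^2 <= P (f^2), and pi is
    invariant. *)
Lemma norm2_kop f : bmf f -> norm2 (kop P f) <= norm2 f.
Proof.
move=> bf; rewrite ler_sqrt ?dot_ge0// {2}/dot -(mean_kop rev); last exact: bmfM.
apply: le_mean => //; [by apply: bmfM; exact: bmf_kop|by apply: bmf_kop; exact: bmfM|].
move=> x; set c := kop P f x.
have : 0 <= kop P (fun y => (f y * f y + (- (2 * c)) * f y) + c * c) x.
  by apply: Rintegral_ge0 => y _; have -> : f y * f y + - (2 * c) * f y + c * c =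
    (f y - c) ^+ 2 by [ring|]; exact: sqr_ge0.
have b1 : bmf (fun y => f y * f y) by exact: bmfM.
have b2 : bmf (fun y => - (2 * c) * f y) by exact: bmfZ.
rewrite (kopD _ (bmfD b1 b2) (bmf_cst _ _)) (kopD _ b1 b2) (kopZ _ _ bf) kop_cst.
rewrite -/c; set u := kop P _ x => H; rewrite -subr_ge0 (le_trans H)//.
by have -> : u + - (2 * c) * c + c * c = u - c * c by ring.
Qed.

End second_moments.

(** * Decay of a log-convex sequence from a renewal inequality *)

Section renewal_decay.
Variable R : realType.
Local Open Scope ring_scope.
Implicit Types (g v e : nat -> R) (x y q s C eta : R).

(* (1 + x) sum_i (-1)^i g_i x^i telescopes to 1 - sum_i (-x)^i (g_{i-1} - g_i);
   the odd terms of the latter only help. *)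
Lemma alternating_sum_ge g x J : 0 <= x -> g 0%N = 1 ->
  (forall i, g i.+1 <= g i) ->
  1 - \sum_(j < J) x ^+ (2 * j.+1) * (g (2 * j).+1 - g (2 * j).+2)
    - x ^+ (2 * J) * g (2 * J)%N <=
  (1 + x) * \sum_(j < J) (g (2 * j)%N * x ^+ (2 * j) - g (2 * j).+1 * x ^+ (2 * j).+1).
Proof.
move=> x0 g0 gS; elim: J => [|J IHJ].
  by rewrite !big_ord0 muln0 expr0 g0 mul1r subr0 subrr mulr0.
rewrite !big_ord_recr/= mulrDr mulnS add2n.
set a := \sum_(_ < J) _ in IHJ *; set b := \sum_(_ < J) _ in IHJ *.
have : 0 <= (g (2 * J)%N - g (2 * J).+1) * x ^+ (2 * J).+1.
  by rewrite mulr_ge0 ?subr_ge0 ?exprn_ge0.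
by move: IHJ; rewrite !exprS; nra.
Qed.

Lemma sum_ord_double (h : nat -> R) J :
  \sum_(i < 2 * J) h i = \sum_(j < J) (h (2 * j)%N + h (2 * j).+1).
Proof.
elim: J => [|J IHJ]; first by rewrite muln0 !big_ord0.
by rewrite mulnS add2n !big_ord_recr/= IHJ addrA.
Qed.

Lemma geometric_tail_le y a b : 0 <= y -> \sum_(a <= i < b) y ^+ i * (1 - y) <= y ^+ a.
Proof.
move=> y0; have [ba|ab] := leqP b a; first by rewrite big_geq// exprn_ge0.
under eq_bigr do rewrite mulrBr mulr1 -exprSr -opprB.
by rewrite sumrN telescope_sumr ?(ltnW ab)// opprB lerBlDr lerDl exprn_ge0.
Qed.

Lemma cvg_sum_ord J (F : 'I_J -> nat -> R) (l : 'I_J -> R) :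
  (forall j, F j n @[n --> \oo] --> l j) ->
  \sum_(j < J) F j n @[n --> \oo] --> \sum_(j < J) l j.
Proof.
elim: J F l => [|J IHJ] F l Fl.
  by rewrite big_ord0; under eq_fun do rewrite big_ord0; exact: cvg_cst.
rewrite big_ord_recr; under eq_fun do rewrite big_ord_recr.
by apply: cvgD => //; exact: IHJ.
Qed.

Lemma even_or_odd i : exists j, i = (2 * j)%N \/ i = (2 * j).+1.
Proof.
by exists i./2; case: (boolP (odd i)) => oi; [right|left];
  rewrite -[LHS]odd_double_half mul2n ?oi ?(negbTE oi).
Qed.

Lemma double_subS N j : (j < N)%N -> (2 * N - (2 * j).+1)%N = (2 * (N - j.+1)).+1.
Proof. lia. Qed.

Section growth.
Variables (e : nat -> R) (k : nat).
Hypothesis e_ge0 : forall m, 0 <= e m.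
Hypothesis e_dec : forall m, e m.+1 <= e m.
Hypothesis e_logconvex : forall m, e m.+1 ^+ 2 <= e m * e m.+2.
Hypothesis ek_gt0 : 0 < e k.+1.
Let x0 := e k / e k.+1.
Let D n := e (k + n)%N / e (k + n).+1.

Lemma decrease_from0 m : e m <= e 0%N.
Proof. by elim: m => // m; exact/le_trans. Qed.

(** By log-convexity a zero of [e] would force a zero just before it, so positivity propagates
    forward. *)
Lemma growth_gt0 n : 0 < e (k + n)%N.
Proof.
suff : 0 < e (k + n)%N /\ 0 < e (k + n).+1 by case.
elim: n => [|n [_ IHn]]; first by rewrite addn0; split=> //; exact: lt_le_trans (e_dec k).
rewrite addnS; split=> //; rewrite lt_def e_ge0 andbT; apply/eqP => e0.
have := e_logconvex (k + n)%N; rewrite e0 mulr0 leNgt => /negP; apply.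
by rewrite exprn_gt0.
Qed.

Lemma ratio_decreasing n : D n.+1 <= D n.
Proof.
rewrite /D addnS ler_pdivrMr; last by rewrite -!addnS growth_gt0.
rewrite mulrAC ler_pdivlMr; last by rewrite -addnS growth_gt0.
by rewrite -expr2.
Qed.

Lemma ratio_ge1 n : 1 <= D n.
Proof. by rewrite /D ler_pdivlMr ?mul1r// -addnS growth_gt0. Qed.

Lemma ratio_le_first n : D n <= x0.
Proof.
elim: n => [|n IHn]; first by rewrite /D addn0.
exact: le_trans (ratio_decreasing n) IHn.
Qed.

Lemma growth_le n j : e (k + n)%N <= x0 ^+ j * e (k + n + j)%N.
Proof.
elim: j => [|j IHj]; first by rewrite addn0 mul1r.
rewrite (le_trans IHj)// exprSr -mulrA ler_wpM2l//.
  by rewrite exprn_ge0// (le_trans _ (ratio_le_first 0))// (le_trans ler01)// ratio_ge1.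
rewrite addnS -ler_pdivrMr; first by rewrite -addnA ratio_le_first.
by rewrite -addnA -addnS growth_gt0.
Qed.

(** From time k on the ratios are at most [x0]. Before k, [e] is at most [e 0], and the factor
    [e 0 / e k] compensates. *)
Lemma growth_dominated N j : (k <= N)%N -> (j <= N)%N ->
  e (N - j)%N <= e 0%N / e k * x0 ^+ j * e N.
Proof.
move=> kN jN; have x01 : 1 <= x0 := le_trans (ratio_ge1 0) (ratio_le_first 0).
have := growth_gt0 0; rewrite addn0 => ek0.
have K1 : 1 <= e 0%N / e k by rewrite ler_pdivlMr// mul1r decrease_from0.
have [n NE] : exists n, N = (k + n)%N by exists (N - k)%N; rewrite subnKC.
have [jn|nj] := leqP j n.
  have := growth_le (n - j)%N j; rewrite -addnA subnK// -NE.
  have -> : (k + (n - j) = N - j)%N by lia.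
  move=> /le_trans; apply; rewrite -mulrA ler_peMl//.
  by rewrite mulr_ge0// exprn_ge0// (le_trans ler01).
rewrite (le_trans (decrease_from0 _))// -mulrA mulrAC ler_pdivlMr// mulrC.
rewrite mulrC ler_wpM2l//.
have := growth_le 0 n; rewrite addn0 -NE => /le_trans; apply.
by rewrite ler_wpM2r// ler_weXn2l// ltnW.
Qed.

Lemma ratio_cvg : exists2 x, 1 <= x <= x0 & D n @[n --> \oo] --> x.
Proof.
have lbD : has_lbound (range D) by exists 1 => _ [n _ <-]; exact: ratio_ge1.
have Dcvg : D n @[n --> \oo] --> inf (range D).
  by apply: nonincreasing_cvgn => //; apply/nonincreasing_seqP; exact: ratio_decreasing.
exists (inf (range D)) => //; apply/andP; split.
  by apply: lb_le_inf; [exists (D 0%N), 0%N | move=> _ [n _ <-]; exact: ratio_ge1].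
by rewrite (le_trans (ge_inf lbD _) (ratio_le_first 0))//; exists 0%N.
Qed.

(* The index is written so that the truncated subtraction never truncates. *)
Lemma shifted_ratio_cvg x J j : (j <= J)%N -> D n @[n --> \oo] --> x ->
  e (k + (n + (J - j)))%N / e (k + (n + J))%N @[n --> \oo] --> x ^+ j.
Proof.
move=> + Dx; elim: j => [_|j IHj jJ].
  rewrite subn0 expr0; under eq_fun do rewrite divff ?gt_eqF ?growth_gt0//.
  exact: cvg_cst.
have -> : (fun n => e (k + (n + (J - j.+1)))%N / e (k + (n + J))%N) =
  (fun n => D (n + (J - j.+1))%N * (e (k + (n + (J - j)))%N / e (k + (n + J))%N)).
  apply/funext => n; rewrite /D -addnS -[(n + _).+1]addnS -subSn//= subSS mulrA.
  by rewrite divfK// gt_eqF// growth_gt0.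
rewrite exprS; apply: cvgM; last by apply: IHj; exact: ltnW.
by move: Dx; rewrite -(cvg_shiftn (J - j.+1)).
Qed.

End growth.

(* If the decay were slower than s, log-convexity would make the ratios
   e n / e n.+1 decrease to some x < s; dividing the renewal equation at time
   2 N by (e N)^2 and letting N tend to infinity would give
   sum_i (-1)^i g_i x^i <= 0, against [alternating_sum_ge]. *)
Lemma renewal_decay g v e C q s eta :
  (forall i, 0 <= g i <= C * q ^+ i) -> (forall i, g i.+1 <= g i) -> g 0%N = 1 ->
  (forall m, 0 <= e m) -> (forall m, e m.+1 <= e m) ->
  (forall m, e m.+1 ^+ 2 <= e m * e m.+2) ->
  (forall m, v (2 * m)%N = e m ^+ 2) ->
  (forall m, `|v (2 * m).+1| <= e m * e m.+1) ->
  (forall n, `|\sum_(i < n.+1) g i * v (n - i)%N| <= C * q ^+ n) ->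
  0 < q -> 0 <= s -> s * q < 1 -> eta < 1 ->
  (forall N, \sum_(j < N) s ^+ (2 * j.+1) * (g (2 * j).+1 - g (2 * j).+2) <= eta) ->
  forall m, e m.+1 * s <= e m.
Proof.
move=> gC gS g0 e_ge0 e_dec e_lc v_even v_odd vC q0 s0 sq1 eta1 sumF.
move=> m; rewrite leNgt; apply/negP => ems.
have ek : 0 < e m.+1.
  by rewrite lt_def e_ge0 andbT; apply: contraTneq ems => ->; rewrite mul0r -leNgt.
have [x /andP[x1 xx0] Dx] := ratio_cvg e_ge0 e_dec e_lc ek.
set x0 := e m / e m.+1 in xx0; have x0s : x0 < s by rewrite /x0 ltr_pdivrMr// mulrC.
have x0_ge1 : 1 <= x0 by exact: le_trans xx0.
have C1 : 1 <= C by have := gC 0%N; rewrite g0 expr0 mulr1 => /andP[].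
have C0 : 0 <= C by exact: le_trans C1.
(* In the renewal sum [g i] decays like q^i while [v (2 * N - i)] grows at most like x0^i: the terms
   are dominated by powers of y. *)
pose y := q * x0.
have yE i : y ^+ i = q ^+ i * x0 ^+ i by exact: exprMn.
have y0 : 0 < y by rewrite mulr_gt0// (lt_le_trans ltr01).
have y1 : y < 1 by rewrite (le_lt_trans _ sq1)// /y mulrC ler_pM2r// ltW.
pose K := e 0%N / e m.
have em : 0 < e m by exact: lt_le_trans (e_dec m).
have K0 : 0 <= K by rewrite divr_ge0.
(* The first summand accounts for the right side C q^(2 N), the second for the terms of index at
   least 2 J, both over (e N)^2. *)
pose B := C / e m ^+ 2 + C * K ^+ 2 / (1 - y).
(* Truncation at 2 J terms with an error uniform in N. Even-indexed v are squares; odd-indexed ones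
   are bounded below by minus a product of neighbouring e. *)
have key N J : (m <= N)%N -> (J <= N)%N ->
  \sum_(j < J) (g (2 * j)%N * (e (N - j)%N / e N) ^+ 2
     - g (2 * j).+1 * (e (N - j)%N / e N) * (e (N - j.+1)%N / e N)) <= B * y ^+ (2 * J).
  move=> mN JN; have eN : 0 < e N.
    by have := growth_gt0 e_ge0 e_dec e_lc ek (N - m); rewrite subnKC.
  have vN i : (i <= 2 * N)%N -> `|v (2 * N - i)%N| <= K ^+ 2 * x0 ^+ i * e N ^+ 2.
    have dom := growth_dominated e_ge0 e_dec e_lc ek mN.
    have [j [->|->] jN] := even_or_odd i.
      rewrite -mulnBr v_even ger0_norm ?sqr_ge0// expr2.
      have {}jN : (j <= N)%N by rewrite leq_mul2l in jN.
      apply: le_trans (ler_pM _ _ (dom j jN) (dom j jN)) _ => //.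
      by rewrite mul2n -addnn exprD le_eqVlt -/x0 -/K; apply/orP; left; apply/eqP; ring.
    have {}jN : (j < N)%N by rewrite ltn_pmul2l in jN.
    rewrite double_subS// (le_trans (v_odd _))// subnSK//.
    apply: le_trans (ler_pM _ _ (dom j.+1 jN) (dom j (ltnW jN))) _ => //.
    by rewrite mul2n -addnn -addSn exprD le_eqVlt -/x0 -/K; apply/orP; left; apply/eqP; ring.
  have tailN : \sum_(2 * J <= i < (2 * N).+1) `|g i * v (2 * N - i)%N| <=
      C * K ^+ 2 / (1 - y) * y ^+ (2 * J) * e N ^+ 2.
    apply: (@le_trans _ _ (\sum_(2 * J <= i < (2 * N).+1) (C * K ^+ 2 * e N ^+ 2) * y ^+ i)).
      apply: ler_sum_nat => i /andP[_ iN]; have /andP[g1 g2] := gC i.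
      rewrite normrM (ger0_norm g1) (le_trans (ler_pM _ _ g2 (vN _ iN)))//.
      by rewrite yE le_eqVlt; apply/orP; left; apply/eqP; ring.
    rewrite -mulr_sumr
      (_ : _ * _ / _ * _ * _ = (C * K ^+ 2 * e N ^+ 2) * (y ^+ (2 * J) / (1 - y))); last by ring.
    apply: (ler_wpM2l (mulr_ge0 (mulr_ge0 C0 (sqr_ge0 _)) (sqr_ge0 _))).
    rewrite ler_pdivlMr ?subr_gt0// mulr_suml.
    exact/geometric_tail_le/ltW.
  (* Comparing with (e N)^2 through e m <= x0^N e N costs x0^(2 N), which turns q^(2 N) into y^(2
     N). *)
  have qN : C * q ^+ (2 * N) <= C / e m ^+ 2 * y ^+ (2 * J) * e N ^+ 2.
    have eNm : e m <= x0 ^+ N * e N.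
      have := growth_le e_ge0 e_dec e_lc ek 0 (N - m).
      rewrite addn0 subnKC// => /le_trans; apply.
      by rewrite ler_wpM2r// ler_weXn2l// leq_subr.
    rewrite -!mulrA ler_wpM2l// mulrC ler_pdivlMr ?exprn_gt0//.
    apply: (@le_trans _ _ (y ^+ (2 * N) * e N ^+ 2)).
      rewrite yE -mulrA ler_wpM2l ?exprn_ge0 ?(ltW q0)//.
      rewrite mulnC exprM -exprMn lerXn2r// nnegrE// mulr_ge0//.
      by rewrite exprn_ge0// (le_trans ler01).
    by rewrite ler_wpM2r ?sqr_ge0// ler_wiXn2l ?(ltW y0) ?(ltW y1)// leq_mul2l.
  have splitN :
      \sum_(j < J) (g (2 * j)%N * e (N - j)%N ^+ 2
        - g (2 * j).+1 * (e (N - j)%N * e (N - j.+1)%N)) <=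
      C * q ^+ (2 * N) + \sum_(2 * J <= i < (2 * N).+1) `|g i * v (2 * N - i)%N|.
    have := vC (2 * N)%N; rewrite -(big_mkord xpredT (fun i => g i * v (2 * N - i)%N)).
    rewrite (@big_cat_nat _ _ _ (2 * J))//=; last by rewrite leqW// leq_mul2l.
    rewrite big_mkord (sum_ord_double (fun i => g i * v (2 * N - i)%N)).
    move=> /(le_trans (ler_norm _)); rewrite -lerBrDr => H; apply: (le_trans (le_trans _ H)).
      apply: ler_sum => j _; have jN : (j < N)%N := leq_trans (ltn_ord j) JN.
      rewrite -mulnBr v_even lerD2l lerNl -mulrN ler_wpM2l//.
        by have /andP[] := gC (2 * j).+1.
      rewrite double_subS// lerNl; have := v_odd (N - j.+1)%N; rewrite subnSK//.
      by rewrite mulrC ler_norml => /andP[].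
    rewrite lerD2l; apply: le_trans (ler_norm_sum _ _ _).
    by rewrite -normrN ler_norm.
  have -> : \sum_(j < J) (g (2 * j)%N * (e (N - j)%N / e N) ^+ 2
     - g (2 * j).+1 * (e (N - j)%N / e N) * (e (N - j.+1)%N / e N)) =
     (\sum_(j < J) (g (2 * j)%N * e (N - j)%N ^+ 2
       - g (2 * j).+1 * (e (N - j)%N * e (N - j.+1)%N))) / e N ^+ 2.
    rewrite mulr_suml; apply: eq_bigr => j _; rewrite !expr2 invfM; ring.
  rewrite ler_pdivrMr ?exprn_gt0// (le_trans splitN)// (le_trans (lerD qN tailN))//.
  by rewrite /B -!mulrDl.
have lim J : \sum_(j < J) (g (2 * j)%N * x ^+ (2 * j) - g (2 * j).+1 * x ^+ (2 * j).+1)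
   <= B * y ^+ (2 * J).
  (* Here N = m + n + J, which exceeds both m and J as [key] requires and tends to infinity with
     n. *)
  pose r j n := e (m + (n + (J - j)))%N / e (m + (n + J))%N.
  apply: (@ler_cvg_to _ \oo _ _ (fun n => \sum_(j < J)
     (g (2 * j)%N * r j n ^+ 2 - g (2 * j).+1 * r j n * r j.+1 n)) (fun=> B * y ^+ (2 * J))).
  - apply: cvg_sum_ord => j.
    have rx i : (i <= J)%N -> r i n @[n --> \oo] --> x ^+ i.
      by move=> iJ; exact: shifted_ratio_cvg.
    have rj := rx j (ltnW (ltn_ord j)); have rj1 := rx j.+1 (ltn_ord j).
    apply: cvgB.
      by rewrite mulnC exprM; apply: cvgMl_tmp; rewrite expr2; apply: cvgM.
    have -> : (2 * j).+1 = (j + j.+1)%N by rewrite mul2n -addnn addnS.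
    rewrite exprD mulrA; apply: cvgM => //; exact: cvgMl_tmp.
  - exact: cvg_cst.
  - apply: nearW => n; apply: le_trans (key (m + (n + J))%N J _ _); last 2 first.
    + exact: leq_addr.
    + by rewrite addnA leq_addl.
    rewrite le_eqVlt; apply/orP; left; apply/eqP; apply: eq_bigr => j _.
    have subJ i : (i <= J)%N -> (m + (n + J) - i = m + (n + (J - i)))%N.
      by move=> iJ; rewrite !addnA addnBA.
    by rewrite /r -!subJ// ltnW.
(* The limit inequality is multiplied by 1 + x and compared with [alternating_sum_ge], using x < s.
   Then J tends to infinity. *)
have fin J : 1 - eta <= ((1 + x) * B + C) * y ^+ (2 * J).
  have x00 : 0 <= x by exact: le_trans x1.
  have := alternating_sum_ge J x00 g0 gS.
  have sumx : \sum_(j < J) x ^+ (2 * j.+1) * (g (2 * j).+1 - g (2 * j).+2) <= eta.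
    apply: le_trans (sumF J); apply: ler_sum => j _.
    by rewrite ler_wpM2r ?subr_ge0// lerXn2r// ?nnegrE// (le_trans xx0)// ltW.
  have gJ : x ^+ (2 * J) * g (2 * J)%N <= C * y ^+ (2 * J).
    rewrite mulrC yE mulrA; have /andP[g1 g2] := gC (2 * J)%N.
    by rewrite ler_pM// ?exprn_ge0// lerXn2r// nnegrE// (le_trans x00).
  have := lim J; rewrite -(ler_pM2l (_ : 0 < 1 + x)); last first.
    by rewrite (lt_le_trans ltr01)// lerDl.
  rewrite (_ : ((1 + x) * B + C) * y ^+ _ =
    (1 + x) * (B * y ^+ (2 * J)) + C * y ^+ (2 * J)); last first.
    by rewrite mulrDl mulrA.
  set a := (_ * \sum_(j < J) _); set b := \sum_(j < J) _ in sumx *.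
  lra.
suff : 1 - eta <= ((1 + x) * B + C) * 0 by rewrite mulr0 leNgt subr_gt0 eta1.
apply: (@ler_cvg_to _ \oo _ _ (fun=> 1 - eta) (fun J => ((1 + x) * B + C) * (y ^+ 2) ^+ J)).
- exact: cvg_cst.
- apply: cvgMl_tmp; apply: cvg_expr; rewrite ger0_norm ?sqr_ge0//.
  by rewrite expr_lt1// ltW.
- by apply: nearW => J; rewrite -exprM.
Qed.

End renewal_decay.

(** * Chains with an accessible atom *)

Section atom_chain.
Context d (X : measurableType d) (R : realType) (P : R.-pker X ~> X).
Variables (pi : probability X R) (A : set X) (a : X).
Hypothesis rev : reversible P pi.
Hypothesis mA : measurable A.
Local Open Scope ring_scope.
Hypothesis kop_atom : forall x (f : X -> R), A x -> bmf f -> kop P f x = kop P f a.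
Local Notation p := (fine (pi A)).
Hypothesis p_gt0 : 0 < p.
Implicit Types f : X -> R.
Local Notation Q := (ktaboo P (~` A)).
Local Notation t := (tail P A).
Local Notation Pn n f := (iter n (kop P) f).

Let pi1 : pi setT = 1%E := probability_setT pi.
Let bA : bmf (\1_A : X -> R) := bmf_indic R mA.
Let bt k : bmf (t k) := bmf_tail P mA k.

(* [return_tail k] is the probability, starting in A, that tau_A > k. *)
Definition return_tail k : R := kop P (t k) a.
Definition centred x : R := \1_A x - p.
Definition centred_norm m : R := norm2 pi (Pn m centred).
Local Notation g := return_tail.
Local Notation phi := centred.
Local Notation e := centred_norm.

Let bphi : bmf phi. Proof. by apply: bmfB => //; exact: bmf_cst. Qed.

Let p_le1 : p <= 1.
Proof. by rewrite -lee_fin fineK ?fin_num_measure// probability_le1. Qed.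

Lemma return_tail0 : g 0%N = 1.
Proof. by rewrite /return_tail kop_cst. Qed.

Lemma return_tailS_le k : g k.+1 <= g k.
Proof. by apply: le_kop => // x; exact: tailS_le. Qed.

Lemma return_tail_bound k (c : R) : (forall x, t k x <= c) -> 0 <= g k <= c.
Proof.
move=> tc; apply/andP; split.
  by apply: Rintegral_ge0 => x _; exact: tail_ge0.
rewrite (le_trans (ler_norm _))//; apply: kop_norm_le => // x.
by rewrite ger0_norm// tail_ge0.
Qed.

(** Both sides are P_x(tau_A = m + 1), which is the same for all x in A. *)
Lemma return_lawE m x : A x -> kop P (iter m Q \1_A) x = g m - g m.+1.
Proof.
move=> Ax; rewrite iter_ktaboo_indic// kopB//.
by rewrite /return_tail !(@kop_atom x).
Qed.

(** A step starts either in the atom, where [kop P f] is constant, or outside. Both path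
    decompositions below iterate this. *)
Lemma kop_atom_split f x : bmf f -> kop P f x = kop P f a * \1_A x + Q f x.
Proof.
move=> bf; rewrite /ktaboo !indicE in_setC.
have [xA|xA] := boolP (x \in A); rewrite /= ?mulr1 ?mul0r ?addr0 ?mulr0 ?add0r ?mul1r//.
by rewrite (@kop_atom x)//; exact/set_mem.
Qed.

(* Paths are classified by their last visit to A up to time n, the term
   [t n.+1 x] standing for those without one. At a point of A this is the
   renewal equation. *)
Lemma last_exit_decomposition n x :
  1 = \sum_(k < n.+1) g k * Pn (n - k)%N \1_A x + t n.+1 x.
Proof.
elim: n x => [|n IHn] x.
  rewrite big_ord1 return_tail0 mul1r.
  by have := kop_atom_split x (bmf_cst X (1 : R)); rewrite kop_cst mul1r.
have bS : bmf (fun x => \sum_(k < n.+1) g k * Pn (n - k)%N \1_A x).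
  by apply: bmf_sum => k; apply: bmfZ; exact: bmf_iter_kop.
transitivity (kop P (fun x => \sum_(k < n.+1) g k * Pn (n - k)%N \1_A x + t n.+1 x) x).
  rewrite -[LHS]/((fun=> 1) x) -(kop_cst P 1); congr (kop P _ _).
  by apply/funext => y; exact: IHn.
(* P t_(n+1) = g_(n+1) 1_A + t_(n+2) supplies the new summand and the new remainder. *)
rewrite kopD// [in LHS](kop_atom_split _ (bt n.+1)) -/(g n.+1) addrA; congr (_ + _).
rewrite big_ord_recr/= subnn; congr (_ + _).
rewrite [LHS]mean_sum; first last.
- by move=> k; apply: bmfZ; exact: bmf_iter_kop.
- exact: prob_kernel.

apply: eq_bigr => k _; rewrite -[LHS]/(kop P _ x) kopZ; last exact: bmf_iter_kop.
by rewrite subSn// -ltnS.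
Qed.

Lemma mean_centred : \int[pi]_x phi x = 0.
Proof. by rewrite meanB//; [rewrite mean_indic// mean_cst// subrr | exact: bmf_cst]. Qed.

Lemma iter_kop_centred n x : Pn n phi x = Pn n \1_A x - p.
Proof.
elim: n x => // n IHn x; rewrite !iterS (_ : Pn n phi = fun y => Pn n \1_A y - p).
  by rewrite kopB ?kop_cst//; [exact: bmf_iter_kop | exact: bmf_cst].
by apply/funext => y.
Qed.

(** The two iterates differ by a constant, to which phi is orthogonal. *)
Lemma dot_centred_iter n : dot pi phi (Pn n phi) = dot pi phi (Pn n \1_A).
Proof.
rewrite /dot; under eq_Rintegral do rewrite iter_kop_centred mulrBr [_ * p]mulrC.
rewrite meanB//; [|by apply: bmfM => //; exact: bmf_iter_kop|exact: bmfZ].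
by rewrite meanZ// mean_centred mulr0 subr0.
Qed.

Lemma centred_norm_le1 x : `|phi x| <= 1.
Proof.
rewrite /centred indicE ler_norml; have := p_gt0; have := p_le1.
by case: (x \in A) => /= *; apply/andP; split; lra.
Qed.

(** The last-exit decomposition of 1 is integrated against phi; the constant 1 contributes nothing
    since phi has mean 0. *)
Lemma renewal_centred n :
  \sum_(k < n.+1) g k * dot pi phi (Pn (n - k)%N phi) = - dot pi phi (t n.+1).
Proof.
have bM k : bmf (fun x => g k * (phi x * Pn (n - k)%N \1_A x)).
  by apply: bmfZ; apply: bmfM => //; exact: bmf_iter_kop.
transitivity (\int[pi]_x (\sum_(k < n.+1) g k * (phi x * Pn (n - k)%N \1_A x))).
  rewrite mean_sum//; apply: eq_bigr => k _.
  by rewrite dot_centred_iter meanZ//; apply: bmfM => //; exact: bmf_iter_kop.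
have -> : (fun x => \sum_(k < n.+1) g k * (phi x * Pn (n - k)%N \1_A x)) =
          (fun x => phi x - phi x * t n.+1 x).
  apply/funext => x; rewrite (_ : _ - _ = phi x * (1 - t n.+1 x)); last by ring.
  rewrite [X in X - _](last_exit_decomposition n x) addrK mulr_sumr.
  by apply: eq_bigr => k _; rewrite mulrCA.
by rewrite meanB//; [rewrite mean_centred sub0r | exact: bmfM].
Qed.

Lemma centred_decreasing m : e m.+1 <= e m.
Proof. by apply: (norm2_kop rev); exact: bmf_iter_kop. Qed.

Lemma centred_decay (C q s eta : R) :
  0 < q -> (forall n x, t n x <= C * q ^+ n) ->
  0 <= s -> s * q < 1 -> eta < 1 ->
  (forall N, \sum_(j < N) s ^+ (2 * j.+1) * (g (2 * j).+1 - g (2 * j).+2) <= eta) ->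
  forall m, e m.+1 * s <= e m.
Proof.
move=> q0 tC s0 sq1 eta1 sumF.
have bP m : bmf (Pn m phi) by exact: bmf_iter_kop.
have vE i j : dot pi (Pn i phi) (Pn j phi) = dot pi phi (Pn (i + j) phi).
  exact: dot_iter_kopD.
have e2 m : e m ^+ 2 = dot pi phi (Pn (m + m) phi) by rewrite /centred_norm sqr_norm2 vE.
apply: (@renewal_decay R g (fun n => dot pi phi (Pn n phi)) e C q s eta
  _ _ _ _ _ _ _ _ _ q0 s0 sq1 eta1 sumF).
- by move=> i; apply: return_tail_bound.
- exact: return_tailS_le.
- exact: return_tail0.
- by move=> m; exact: norm2_ge0.
- exact: centred_decreasing.
(* Log-convexity is Cauchy-Schwarz for P^m phi and P^(m+2) phi. *)
- move=> m; rewrite e2 (_ : (m.+1 + m.+1 = m + m.+2)%N); last by rewrite !addnS.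
  by rewrite -vE (le_trans (ler_norm _))// dot_le_norm2.
- by move=> m; rewrite e2 mul2n addnn.
- move=> m; rewrite (_ : (2 * m).+1 = (m + m.+1)%N); last by rewrite mul2n -addnn addnS.
  by rewrite -vE dot_le_norm2.
(* The renewal equation at n involves t_(n+1), which is bounded by t_n to match the exponent. *)
- move=> n; rewrite renewal_centred normrN; apply: mean_norm_le => //; first exact: bmfM.
  move=> x; rewrite normrM (ger0_norm (tail_ge0 P A n.+1 x)).
  rewrite -[leRHS]mul1r ler_pM ?tail_ge0 ?centred_norm_le1//.
  by rewrite (le_trans (tailS_le P mA n x))// tC.
Qed.

Lemma norm2_centred : e 0%N = Num.sqrt (p * (1 - p)).
Proof.
rewrite /centred_norm /norm2; congr Num.sqrt; rewrite /= /dot.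
under eq_Rintegral => x _.
  rewrite (_ : phi x * phi x = (1 - 2 * p) * \1_A x + p * p); last first.
    by rewrite /centred indicE; case: (x \in A) => /=; ring.
  over.
rewrite meanD//; [|exact: bmfZ|exact: bmf_cst].
by rewrite (meanZ pi1 _ bA) mean_indic// mean_cst//; ring.
Qed.

Lemma atom_iter_kop m f x : A x -> bmf f -> Pn m.+1 f x = Pn m.+1 f a.
Proof. by move=> Ax bf; rewrite !iterS; apply: kop_atom => //; exact: bmf_iter_kop. Qed.

(** After at least one step P^(m+1) f is constant on A, so the deviation is <phi, P^(m+1) f> / p.
    Symmetry moves the kernel onto phi, and Cauchy-Schwarz applies with ||f|| <= 1. *)
Lemma atom_deviation_le m f : bmf f -> (forall x, `|f x| <= 1) ->
  `|Pn m.+1 f a - \int[pi]_x f x| <= e m.+1 / p.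
Proof.
move=> bf f1; have bP : bmf (Pn m.+1 f) by exact: bmf_iter_kop.
have bPphi : bmf (Pn m.+1 phi) by exact: bmf_iter_kop.
have -> : Pn m.+1 f a - \int[pi]_x f x = dot pi (Pn m.+1 phi) f / p.
  rewrite dot_iter_kop//.
  have -> : dot pi phi (Pn m.+1 f) = p * Pn m.+1 f a - p * \int[pi]_x f x.
    rewrite /dot; under eq_Rintegral do rewrite mulrBl.
    rewrite meanB//; [|exact: bmfM|exact: bmfZ].
    rewrite meanZ// mean_iter_kop//; congr (_ - _).
    under eq_Rintegral => x _.
      rewrite (_ : \1_A x * Pn m.+1 f x = Pn m.+1 f a * \1_A x); last first.
        rewrite indicE mulrC; have [xA|] := boolP (x \in A); last by rewrite !mulr0.
        by rewrite atom_iter_kop//; exact/set_mem.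
      over.
    by rewrite meanZ// mean_indic// mulrC.
  by field; rewrite gt_eqF.
rewrite normrM (ger0_norm (_ : 0 <= p^-1)) ?invr_ge0 ?(ltW p_gt0)//.
rewrite ler_pM2r ?invr_gt0// (le_trans (dot_le_norm2 _ bPphi bf))//.
rewrite -[leRHS]mulr1 ler_wpM2l ?norm2_ge0// -[leRHS]sqrtr1 ler_sqrt//.
rewrite (le_trans (ler_norm _))//; apply: mean_norm_le => //; first exact: bmfM.
by move=> x; rewrite normrM mulr_ile1.
Qed.

(** Paths are classified by their first visit to A at a time k < n. Those entering exactly at n stay
    in the last term, since [f] itself may vary on A. *)
Lemma first_entrance_decomposition n f x : bmf f ->
  Pn n f x = \sum_(k < n) Pn (n - k)%N f a * (t k x - t k.+1 x) + iter n Q f x.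
Proof.
move=> bf; elim: n x => [|n IHn] x; first by rewrite big_ord0 add0r.
have bP : bmf (Pn n f) by exact: bmf_iter_kop.
have bw (k : 'I_n) : bmf (fun x => Pn (n - k)%N f a * (t k x - t k.+1 x)).
  by apply: bmfZ; exact: bmfB.
have bS := bmf_sum bw.
have bQ : bmf (iter n Q f) by apply: bmf_iter_ktaboo => //; exact: measurableC.
rewrite iterS kop_atom_split// big_ord_recl subn0 -addrA; congr (_ + _).
  by congr (_ * _); have := congr1 (@^~ x) (iter_ktaboo_indic P mA 0).
rewrite (_ : Pn n f = fun x =>
  \sum_(k < n) Pn (n - k)%N f a * (t k x - t k.+1 x) + iter n Q f x); last first.
  by apply/funext => y; exact: IHn.
rewrite ktabooD// ktaboo_sum//; congr (_ + _); apply: eq_bigr => k _.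
rewrite ktabooZ; last exact: bmfB.
by rewrite ktabooB// lift0 subSS.
Qed.

(* The term [2 * t n x] accounts for the paths that have not visited A before
   time n. *)
Lemma deviation_le n f x : bmf f -> (forall y, `|f y| <= 1) ->
  `|Pn n f x - \int[pi]_y f y| <=
  \sum_(k < n) e (n - k)%N / p * (t k x - t k.+1 x) + 2 * t n x.
Proof.
move=> bf f1; set c := \int[pi]_y f y.
have c1 : `|c| <= 1 by apply: mean_norm_le.
(* The decomposition is applied to f minus its mean, whose sup norm is at most 2. *)
pose h x : R := f x - c; have bh : bmf h by apply: bmfB => //; exact: bmf_cst.
have Pnh m y : Pn m h y = Pn m f y - c.
  elim: m y => // m IHm y; rewrite !iterS (_ : Pn m h = fun y => Pn m f y - c).
    by rewrite kopB ?kop_cst//; [exact: bmf_iter_kop | exact: bmf_cst].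
  by apply/funext => z.
rewrite -Pnh first_entrance_decomposition// (le_trans (ler_normD _ _))// lerD//.
  rewrite (le_trans (ler_norm_sum _ _ _))//; apply: ler_sum => k _.
  rewrite normrM (ger0_norm (_ : 0 <= t k x - t k.+1 x)) ?subr_ge0 ?tailS_le//.
  rewrite ler_wpM2r ?subr_ge0 ?tailS_le// Pnh.
  by rewrite (_ : (n - k = (n - k.+1).+1)%N) ?atom_deviation_le// subnSK.
apply: iter_ktaboo_norm_le => // y; rewrite (le_trans (ler_normB _ _))//.
by rewrite (_ : 2 = 1 + 1 :> R)// lerD.
Qed.

End atom_chain.

(** * Summation estimates for real sequences *)

Section real_bounds.
Variable R : realType.
Local Open Scope ring_scope.
Implicit Types (t e : nat -> R) (s l c D : R).

Lemma iterated_decay e s : 0 <= s -> (forall m, e m.+1 * s <= e m) ->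
  forall m, e m * s ^+ m <= e 0%N.
Proof.
move=> s0 step; elim=> [|m IHm]; first by rewrite expr0 mulr1.
by rewrite exprS mulrA (le_trans _ IHm)// ler_wpM2r ?exprn_ge0.
Qed.

(** For s >= 1 the [t k] get non-negative coefficients on the right, so that upper bounds on them
    can be inserted. Multiplying by s^n makes the summands independent of n, and induction
    applies. *)
Lemma abel_summation t s n : 0 < s -> t 0%N = 1 ->
  \sum_(k < n) s ^- (n - k) * (t k - t k.+1) + t n =
  s ^- n * (1 + (1 - s^-1) * \sum_(k < n) s ^+ k.+1 * t k.+1).
Proof.
move=> s0 t0; have sn m : s ^+ m != 0 by rewrite expf_neq0// gt_eqF.
apply: (mulfI (sn n)); rewrite mulrA divff// mul1r mulrDr mulr_sumr.
have -> : \sum_(k < n) s ^+ n * (s ^- (n - k) * (t k - t k.+1)) =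
    \sum_(k < n) s ^+ k * (t k - t k.+1).
  apply: eq_bigr => k _; rewrite mulrA; congr (_ * _).
  by apply/(mulIf (sn (n - k)%N)); rewrite divfK// -exprD subnKC// ltnW.
elim: n => [|n IHn]; first by rewrite !big_ord0 add0r mul1r t0 mulr0 addr0.
rewrite !big_ord_recr/= [(1 - s^-1) * (_ + _)]mulrDr [RHS]addrA -IHn exprS.
have -> : (1 - s^-1) * (s * s ^+ n * t n.+1) = (s - 1) * s ^+ n * t n.+1.
  by rewrite !mulrA mulrBl mul1r mulVf ?gt_eqF.
by ring.
Qed.

Lemma geometric_sum_ratio s l n : 0 < l ->
  (s - l) * \sum_(k < n) s ^+ k.+1 * l ^- k.+1 = s * (s ^+ n * l ^- n - 1).
Proof.
move=> l0; elim: n => [|n IHn]; first by rewrite big_ord0 !expr0 invr1 mulr1 subrr !mulr0.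
have ln0 : l ^+ n != 0 by rewrite expf_neq0// gt_eqF.
rewrite big_ord_recr/= mulrDr IHn !exprS invfM.
by field; rewrite ln0 gt_eqF.
Qed.

(** Summation by parts needs c (u + v); what is left, (2 - c) v, is the source of (2 - C_1)^+. *)
Lemma split_two_le s c u v : 0 <= v ->
  c * u + 2 * v <= c * (u + v) + Num.max (2 - c) 0 * v.
Proof.
move=> v0; rewrite mulrDr -addrA lerD2l -mulrDl ler_wpM2r//.
by rewrite -lerBlDl le_max lexx.
Qed.

Section tail_bounds.
Variables (t : nat -> R) (s l c D : R) (n : nat).
Hypothesis t0 : t 0%N = 1.
Hypothesis t_ge0 : forall k, 0 <= t k.
Hypothesis tD : forall k, t k <= D * l ^- k.
Hypothesis s_ge1 : 1 <= s.
Hypothesis l_gt1 : 1 < l.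
Hypothesis c_ge0 : 0 <= c.

Let s_gt0 : 0 < s. Proof. exact: lt_le_trans s_ge1. Qed.
Let l_gt0 : 0 < l. Proof. exact: lt_trans l_gt1. Qed.
Let D_ge0 : 0 <= D.
Proof. by have := tD 0; rewrite t0 expr0 invr1 mulr1; exact: le_trans. Qed.
Let V_ge0 : 0 <= 1 - s^-1.
Proof. by rewrite subr_ge0 invf_le1. Qed.

Let start : c * \sum_(k < n) s ^- (n - k) * (t k - t k.+1) + 2 * t n <=
  c * (s ^- n * (1 + (1 - s^-1) * \sum_(k < n) s ^+ k.+1 * (D * l ^- k.+1)))
  + Num.max (2 - c) 0 * (D * l ^- n).
Proof.
apply: le_trans (split_two_le s c _ (t_ge0 n)) _; rewrite abel_summation//.
apply: lerD; last by rewrite ler_wpM2l// le_max lexx orbT.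
rewrite ler_wpM2l// ler_wpM2l ?invr_ge0 ?exprn_ge0 ?(ltW s_gt0)// lerD2l ler_wpM2l//.
by apply: ler_sum => k _; rewrite ler_wpM2l// exprn_ge0// ltW.
Qed.

Lemma deviation_bound_neq : s != l ->
  c * \sum_(k < n) s ^- (n - k) * (t k - t k.+1) + 2 * t n <=
  c * (1 - (s - 1) / (s - l) * (l * D)) * s ^- n
  + (l * D) * (Num.max (2 - c) 0 * l^-1 + (s - 1) / (s - l) * c) * l ^- n.
Proof.
move=> sl; apply: le_trans start _; set m := Num.max _ _.
have slN0 : s - l != 0 by rewrite subr_eq0.
have lN0 : l != 0 by rewrite gt_eqF.
have sN0 : s != 0 by rewrite gt_eqF.
have snN0 : s ^+ n != 0 by rewrite expf_neq0.
have lnN0 : l ^+ n != 0 by rewrite expf_neq0.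
have sumE : \sum_(k < n) s ^+ k.+1 * (D * l ^- k.+1) =
    D * (s * (s ^+ n * l ^- n - 1) / (s - l)).
  rewrite -geometric_sum_ratio// [(s - l) * _]mulrC mulfK// mulr_sumr.
  by apply: eq_bigr => k _; rewrite mulrCA.
(* As a sum G is non-negative whatever the sign of s - l. The stated bound has l G in place of G,
   because M_1 = l D. *)
pose G := (s - 1) * (\sum_(k < n) s ^+ k.+1 * (D * l ^- k.+1)) / s * s ^- n.
have G0 : 0 <= G.
  rewrite /G mulr_ge0 ?invr_ge0 ?exprn_ge0 ?(ltW s_gt0)// divr_ge0 ?(ltW s_gt0)//.
  rewrite mulr_ge0 ?subr_ge0// sumr_ge0// => k _.
  by rewrite mulr_ge0 ?mulr_ge0 ?invr_ge0 ?exprn_ge0 ?(ltW s_gt0) ?(ltW l_gt0).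
have -> : c * (s ^- n * (1 + (1 - s^-1) * (\sum_(k < n) s ^+ k.+1 * (D * l ^- k.+1)))) =
    c * s ^- n + c * G.
  by rewrite /G; field; rewrite snN0.
have -> : c * (1 - (s - 1) / (s - l) * (l * D)) * s ^- n
  + (l * D) * (m * l^-1 + (s - 1) / (s - l) * c) * l ^- n =
   c * s ^- n + c * (l * G) + m * (D * l ^- n).
  by rewrite /G sumE; field; rewrite snN0 lnN0 lN0 slN0 sN0.
by rewrite lerD2r lerD2l ler_wpM2l// ler_peMl// ltW.
Qed.

(** At equal rates every term of the geometric sum is D, whence the factor n. *)
Lemma deviation_bound_eq : s = l ->
  c * \sum_(k < n) s ^- (n - k) * (t k - t k.+1) + 2 * t n <=
  (c + Num.max (2 - c) 0 * s^-1 * (l * D) + c * (1 - s^-1) * (l * D) * n%:R) * s ^- n.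
Proof.
move=> sl; apply: le_trans start _; set m := Num.max _ _; rewrite -sl.
have sN0 : s != 0 by rewrite gt_eqF.
have snN0 : s ^+ n != 0 by rewrite expf_neq0.
have -> : \sum_(k < n) s ^+ k.+1 * (D * s ^- k.+1) = n%:R * D.
  rewrite (eq_bigr (fun=> D)) ?sumr_const ?card_ord ?mulr_natl// => k _.
  by rewrite mulrCA divff ?mulr1// expf_neq0.
have -> : (c + m * s^-1 * (s * D) + c * (1 - s^-1) * (s * D) * n%:R) * s ^- n =
   c * (s ^- n * (1 + (1 - s^-1) * (n%:R * (s * D)))) + m * (D * s ^- n).
  by field; rewrite snN0 sN0.
rewrite lerD2r ler_wpM2l// ler_wpM2l ?invr_ge0 ?exprn_ge0 ?(ltW s_gt0)//.
by rewrite lerD2l ler_wpM2l// ler_wpM2l// ler_peMl.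
Qed.

End tail_bounds.
End real_bounds.

(** * The kernel norm and the series of even return probabilities *)

Section atom_norms.
Context d dO (X : measurableType d) (Omega : measurableType dO) (R : realType).
Variables (P : R.-pker X ~> X) (Pr : X -> probability Omega R).
Variable Phi : nat -> {mfun Omega >-> X}.
Variable pi : probability X R.
Hypothesis chain : markov_chain P Pr Phi.
Local Open Scope ring_scope.
Implicit Types f : X -> R.

Lemma kernel_norm_le n (B : R) :
  (forall x f, bmf f -> (forall y, `|f y| <= 1) ->
    `|iter n (kop P) f x - \int[pi]_y f y| <= B) ->
  (kernel_norm Pr Phi pi n <= B%:E)%E.
Proof.
move=> dev; apply: ge_ereal_sup => _ [x _ <-]; apply: ge_ereal_sup => _ [f [mf f1] <-].
have bf : bmf f by split => //; exists 1.
rewrite mean_EFin//; last exact: probability_setT.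
rewrite mean_EFin//; last exact: probability_setT.
by rewrite (mean_nstep chain)// -EFinB lee_fin dev.
Qed.

Lemma atom_kop A : atom P A -> forall x a f, A x -> A a -> bmf f ->
  kop P f x = kop P f a.
Proof.
move=> [_ [nu Pnu]] x a f Ax Aa bf.
have bl z : bounded_linear (fun f : X -> R => kop P f z).
  apply: (bounded_linear_comp_kop P (L := @^~ z)).
  by split=> //; exists 1 => g K _ gK; rewrite mul1r.
apply: (bounded_linear_eq (bl x) (bl a)) => // B mB.
by apply: EFin_inj; rewrite !kop_indic// !Pnu.
Qed.

Section return_series.
Variables (A : set X) (a : X).
Hypotheses (mA : measurable A) (atA : atom P A) (Aa : A a).
Local Notation g := (return_tail P A a).

Let kopA x f : A x -> bmf f -> kop P f x = kop P f a.
Proof. by move=> Ax; exact: (atom_kop atA). Qed.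

Lemma return_series_partial (s : R) x N : A x ->
  (\sum_(1 <= n < N.+1) (s ^+ (2 * n))%:E * first_return Pr Phi (2 * n) x A)%E =
  (\sum_(j < N) s ^+ (2 * j.+1) * (g (2 * j).+1 - g (2 * j).+2))%:E.
Proof.
move=> Ax; rewrite big_add1/= big_mkord -sumEFin; apply: eq_bigr => j _.
rewrite EFinM; congr (_ * _)%E.
by rewrite mulnS add2n (first_returnE chain mA) (return_lawE mA kopA).
Qed.

Let term_ge0 (s : R) x n : 0 <= s ->
  (0 <= (s ^+ (2 * n))%:E * first_return Pr Phi (2 * n) x A)%E.
Proof. by move=> s0; rewrite mule_ge0// lee_fin exprn_ge0. Qed.

(** eta is the value of the series at [a], which dominates its partial sums. *)
Lemma return_series_bound (s : R) : 0 <= s ->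
  (ereal_sup [set \sum_(1 <= n <oo) (s ^+ (2 * n))%:E * first_return Pr Phi (2 * n) x A
     | x in A] < 1)%E ->
  exists2 eta, eta < 1 & forall N,
    \sum_(j < N) s ^+ (2 * j.+1) * (g (2 * j).+1 - g (2 * j).+2) <= eta.
Proof.
move=> s0 sup1.
set z := (\sum_(1 <= n <oo) (s ^+ (2 * n))%:E * first_return Pr Phi (2 * n) a A)%E.
have z1 : (z < 1)%E.
  by apply: le_lt_trans sup1; apply: ereal_sup_ubound; exists a.
have z0 : (0 <= z)%E by apply: nneseries_ge0 => n _ _; exact: term_ge0.
have zfin : z \is a fin_num by rewrite ge0_fin_numE// (lt_trans z1)// ltry.
exists (fine z); first by rewrite -lte_fin fineK.
move=> N; rewrite -lee_fin fineK// -(return_series_partial s N Aa).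
by apply: nneseries_lim_ge => n _ _; exact: term_ge0.
Qed.

(** The even return probabilities sum to at most 1 and s^(2n) <= s^2 < 1. This yields rho >= 1. *)
Lemma return_series_lt1 (s : R) : 0 <= s -> s < 1 ->
  (ereal_sup [set \sum_(1 <= n <oo) (s ^+ (2 * n))%:E * first_return Pr Phi (2 * n) x A
     | x in A] < 1)%E.
Proof.
move=> s0 s1; have g_ge0 k : 0 <= g k.
  by have /andP[] := return_tail_bound a mA (tail_le1 P mA k).
have gS := return_tailS_le P a mA.
have sumg N : \sum_(j < N) (g (2 * j).+1 - g (2 * j).+2) + g (2 * N)%N <= 1.
  elim: N => [|N IHN]; first by rewrite big_ord0 add0r return_tail0.
  apply: le_trans IHN; rewrite big_ord_recr/= -addrA lerD2l mulnS add2n subrK.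
  exact: gS.
apply: (@le_lt_trans _ _ (s ^+ 2)%:E); last by rewrite lte_fin expr_lt1.
apply: ge_ereal_sup => _ [x Ax <-]; apply: lime_le.
  by apply: is_cvg_nneseries => n _ _; exact: term_ge0.
apply: nearW => -[|N]; first by rewrite big_geq// lee_fin sqr_ge0.
rewrite return_series_partial// lee_fin.
apply: (@le_trans _ _ (s ^+ 2 * \sum_(j < N) (g (2 * j).+1 - g (2 * j).+2))).
  rewrite mulr_sumr; apply: ler_sum => j _; rewrite ler_wpM2r ?subr_ge0//.
  by rewrite ler_wiXn2l ?(ltW s1)// leq_pmulr.
by rewrite ler_piMr ?sqr_ge0// (le_trans _ (sumg N))// lerDl g_ge0.
Qed.

End return_series.

End atom_norms.

(** * Constants and rates of the theorem *)

Section exponential_bounds.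
Variable R : realType.
Local Open Scope ring_scope.

Lemma mul_ln_lt1 (m l : R) : 0 <= m -> 1 < l -> (l%:E < expeR m%:E^-1)%E -> m * ln l < 1.
Proof.
move=> m0 l1; have l0 : 0 < l by exact: lt_trans l1.
have [->|mN0] := eqVneq m 0; first by rewrite mul0r.
have {}m0 : 0 < m by rewrite lt_def mN0.
rewrite inver (negPf mN0)/= lte_fin => lm.
by rewrite mulrC -ltr_pdivlMr// mul1r -ltr_expR lnK.
Qed.

(** With p = pi(A), it turns ||phi|| into C_1 pi(A). *)
Lemma sqrt_odds (p : R) : 0 < p <= 1 ->
  Num.sqrt (p * (1 - p)) = Num.sqrt (p^-1 - 1) * p.
Proof.
move=> /andP[p0 p1]; have odds : 0 <= p^-1 - 1 by rewrite subr_ge0 invf_ge1.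
rewrite -[X in _ = _ * X](gtr0_norm p0) -sqrtr_sqr -sqrtrM//.
by congr Num.sqrt; field; rewrite gt_eqF.
Qed.

(** Used with y = e^{1/M}, possibly +oo, to find a tail rate strictly above an admissible s. *)
Lemma exists_between (s l : R) (y : \bar R) : (s%:E < y)%E -> (l%:E < y)%E ->
  exists z, [/\ s < z, l < z & (z%:E < y)%E].
Proof.
have [b sb lb] : exists2 b, s <= b & l <= b.
  by exists (Num.max s l); rewrite le_max lexx ?orbT.
move=> sy ly; suff [z bz zy] : exists2 z, Num.max s l < z & (z%:E < y)%E.
  by exists z; move: bz; rewrite gt_max => /andP[].
have by_ : ((Num.max s l)%:E < y)%E by rewrite /Num.max; case: ifP.
case: y by_ {sy ly} => [y| |] by_.
- by exists ((Num.max s l + y) / 2); rewrite ?lte_fin; rewrite lte_fin in by_; lra.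
- by exists (Num.max s l + 1); rewrite ?ltry//; lra.
- by [].
Qed.

End exponential_bounds.

(* If M = 0 then M^-1 = +oo, e^{1/M} = +oo and rho = +oo, whence r = 0; in that
   case A = X and C1 = 0, so all terms involving r vanish. *)
Theorem theorem4p1 (R : realType) (d dO : measure_display)
    (X : measurableType d) (Omega : measurableType dO)
    (P : R.-pker X ~> X) (Pr : X -> probability Omega R)
    (Phi : nat -> {mfun Omega >-> X}) (pi : probability X R) (A : set X) :
  countably_generated X ->
  markov_chain P Pr Phi ->
  unique_invariant P pi ->
  irreducible Pr Phi pi ->
  (forall (n : nat) (x : X), (1 <= n)%N -> nstep Pr Phi n x `<< pi) ->
  reversible P pi ->
  accessible_atom P pi A ->
  let M : \bar R :=
    ereal_sup [set \int[Pr x]_w sigma R Phi A w | x in [set: X]] in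
  M < +oo ->
  let rho : \bar R :=
    ereal_sup [set s%:E | s in [set s : R |
      [/\ (0 <= s)%R, s%:E < expeR M^-1 &
          ereal_sup [set \sum_(1 <= n <oo)
            (s ^+ (2 * n))%:E * first_return Pr Phi (2 * n) x A | x in A]
          < 1]]] in
  forall (lambda : R) (n : nat),
  (1 < lambda)%R -> lambda%:E < expeR M^-1 ->
  let r : R := fine rho in
  let C1 : R := Num.sqrt ((fine (pi A))^-1 - 1) in
  let M1 : R := (lambda * (1 - fine M * ln lambda)^-1)%R in
  let F1 : R := (C1 * (1 - (r - 1) / (r - lambda) * M1))%R in
  let G1 : R := (M1 * (Num.max (2 - C1) 0 * lambda^-1
                       + (r - 1) / (r - lambda) * C1))%R in
  let J1 : R := (C1 + Num.max (2 - C1) 0 * r^-1 * M1)%R in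
  let K1 : R := (C1 * (1 - r^-1) * M1)%R in
  (lambda%:E != rho ->
     kernel_norm Pr Phi pi n <= (F1 * r ^- n + G1 * lambda ^- n)%:E) /\
  (lambda%:E = rho ->
     kernel_norm Pr Phi pi n <= ((J1 + K1 * n%:R) * r ^- n)%:E).
Proof.
move=> _ chain _ _ _ rev [atA piA_gt0] M Mfin rho lambda n l1 lM r C1 M1 F1 G1 J1 K1.
have mA : measurable A := atA.1.
have [a Aa] : exists a, A a.
  apply: contrapT => A0; move: piA_gt0; rewrite (_ : A = set0) ?measure0 ?ltxx//.
  by apply/seteqP; split => // x Ax; apply: A0; exists x.
have kopA x f : A x -> bmf f -> kop P f x = kop P f a.
  by move=> Ax; exact: (atom_kop atA).
have p_gt0 : (0 < fine (pi A))%R.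
  by rewrite fine_gt0// piA_gt0/= (le_lt_trans (probability_le1 _ mA))// ltry.
have p_le1 : (fine (pi A) <= 1)%R.
  by rewrite -lee_fin fineK ?fin_num_measure// probability_le1.
have M_ub x : \int[Pr x]_w sigma R Phi A w <= M by apply: ereal_sup_ubound; exists x.
have M_ge0 : 0 <= M.
  apply: le_trans (M_ub a); apply: integral_ge0 => w _.
  by apply: le_ereal_inf_tmp => _ [k _ <-]; rewrite lee_fin.
have MfinE : M \is a fin_num by rewrite ge0_fin_numE.
pose m := fine M; have ME : M = m%:E by rewrite fineK.
have m_ge0 : (0 <= m)%R by rewrite fine_ge0.
have sumM N x : (\sum_(k < N) tail P A k.+1 x <= m)%R.
  rewrite -lee_fin -ME; apply: le_trans (M_ub x).
  exact: (sum_tail_le_mean_sigma chain mA).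
have tail_bound (l : R) : (1 < l)%R -> l%:E < expeR M^-1 -> forall k x,
    (tail P A k x <= (1 - m * ln l)^-1 * l ^- k)%R.
  by move=> l_gt1 lM'; apply: tail_geometric => //; apply: mul_ln_lt1 => //; rewrite -ME.
set e := centred_norm P pi A.
have e_decr k : (e k.+1 <= e k)%R by exact: centred_decreasing.
have C1_ge0 : (0 <= C1)%R by exact: sqrtr_ge0.
have e0E : e 0%N = (C1 * fine (pi A))%R.
  by rewrite /e norm2_centred// sqrt_odds// p_gt0.
have e_valid s : (0 <= s)%R -> s%:E < expeR M^-1 ->
    ereal_sup [set \sum_(1 <= n <oo)
      (s ^+ (2 * n))%:E * first_return Pr Phi (2 * n) x A | x in A] < 1 ->
    forall k, (e k.+1 * s <= e k)%R.
  move=> s0 sM sup1.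
  have [eta eta1 sum_eta] := return_series_bound chain mA atA Aa s0 sup1.
  (* Above lambda, l exceeds 1; above s, it gives s / l < 1 for the renewal argument. *)
  have [l [sl ll lM']] := exists_between sM lM.
  have l_gt1 : (1 < l)%R by exact: lt_trans ll.
  have l_gt0 : (0 < l)%R by exact: lt_trans l_gt1.
  apply: (centred_decay (C := (1 - m * ln l)^-1%R) (q := l^-1%R)
    rev mA kopA p_gt0 _ _ s0 _ eta1 sum_eta); first by rewrite invr_gt0.
    by move=> k x; rewrite exprVn; exact: tail_bound.
  by rewrite ltr_pdivrMr// mul1r.
have lambda_gt0 : (0 < lambda)%R by exact: lt_trans l1.
pose D : R := ((1 - m * ln lambda)^-1)%R.
have tD := tail_bound _ l1 lM.
have M1E : M1 = (lambda * D)%R by [].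
have dev_le x f : bmf f -> (forall y, (`|f y| <= 1)%R) ->
    (`|iter n (kop P) f x - \int[pi]_y f y| <=
    \sum_(k < n) e (n - k)%N / fine (pi A) * (tail P A k x - tail P A k.+1 x) +
      2 * tail P A n x)%R.
  exact: (deviation_le rev mA kopA p_gt0).
(* If C1 = 0 then every [e k] vanishes, and the deviation is at most 2 t_n. *)
have [C1_0|C1_neq0] := eqVneq C1 0%R.
  have e_0 k : e k = 0%R.
    have e0 : e 0%N = 0%R by rewrite e0E C1_0 mul0r.
    apply/eqP; rewrite eq_le norm2_ge0 andbT -e0.
    by elim: k => // k; exact: le_trans.
  have normB : kernel_norm Pr Phi pi n <= (2 * (D * lambda ^- n))%:E.
    apply: (kernel_norm_le chain) => x f bf f1; apply: le_trans (dev_le x f bf f1) _.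
    rewrite big1 ?add0r; last by move=> k _; rewrite e_0 !mul0r.
    by rewrite ler_pM2l// tD.
  have max2 : (Num.max 2 0 = 2 :> R)%R by rewrite max_l.
  split=> [_|lE]; apply: le_trans normB _;
    rewrite lee_fin le_eqVlt; apply/orP; left; apply/eqP.
    rewrite /F1 /G1 C1_0 subr0 max2 M1E !(mul0r, mulr0) addr0 add0r.
    by field; rewrite expf_neq0// gt_eqF.
  have rE : r = lambda by rewrite /r -lE.
  rewrite /J1 /K1 C1_0 rE subr0 max2 M1E !mul0r add0r addr0.
  by field; rewrite expf_neq0// gt_eqF.
(* Since C1 is nonzero, some x lies outside A, and there t_1 = 1 is at most m. *)
have m_gt0 : (0 < m)%R.
  have [x xA] : exists x, ~ A x.
    apply: contrapT => noA; move/eqP: C1_neq0; apply.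
    have AT : A = setT.
      by apply/seteqP; split => // x _; apply: contrapT => Ax; apply: noA; exists x.
    by rewrite /C1 AT probability_setT invr1 subrr sqrtr0.
  have := sumM 1%N x; rewrite big_ord1/= /ktaboo kop_cst mulr1 indicE in_setC memNset//=.
  exact: lt_le_trans.
have expE : expeR M^-1 = (expR m^-1)%:E by rewrite ME inver gt_eqF.
have rho_le : rho <= (expR m^-1)%:E.
  by apply: ge_ereal_sup => _ [s [_ sM _] <-]; rewrite -expE ltW.
have rho_ge s : (0 <= s)%R -> (s < 1)%R -> s%:E <= rho.
  move=> s0 s1; apply: ereal_sup_ubound; exists s => //; split => //.
    by apply: lt_trans lM; rewrite lte_fin (lt_trans s1).
  exact: (return_series_lt1 chain mA atA Aa).
have rho_fin : rho \is a fin_num.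
  rewrite fin_numElt (le_lt_trans rho_le (ltry _)) andbT.
  by apply: lt_le_trans (rho_ge 0%R _ _) => //; rewrite ltNyr.
have rhoE : rho = r%:E by rewrite fineK.
(* Otherwise (r + 1) / 2 would be an admissible value above r. *)
have r_ge1 : (1 <= r)%R.
  rewrite leNgt; apply/negP => r1.
  have r0 : (0 <= r)%R by rewrite -lee_fin -rhoE rho_ge.
  have := rho_ge ((r + 1) / 2)%R; rewrite rhoE lee_fin => H.
  have : ((r + 1) / 2 <= r)%R by apply: H; lra.
  by lra.
have r_gt0 : (0 < r)%R by exact: lt_le_trans r_ge1.
(* The inequality passes to the supremum: [e k / e k.+1] is an upper bound of all admissible s. *)
have e_r k : (e k.+1 * r <= e k)%R.
  have [->|e_neq0] := eqVneq (e k.+1) 0%R; first by rewrite mul0r norm2_ge0.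
  have e_gt0 : (0 < e k.+1)%R by rewrite lt_def e_neq0 norm2_ge0.
  rewrite mulrC -ler_pdivlMr// -lee_fin -rhoE.
  apply: ge_ereal_sup => _ [s [s0 sM sup1] <-].
  by rewrite lee_fin ler_pdivlMr// mulrC e_valid.
have e_bound k : (e k / fine (pi A) <= C1 * r ^- k)%R.
  rewrite ler_pdivrMr// mulrAC ler_pdivlMr ?exprn_gt0// -e0E.
  exact: (iterated_decay (ltW r_gt0) e_r).
have dev_r x f : bmf f -> (forall y, (`|f y| <= 1)%R) ->
    (`|iter n (kop P) f x - \int[pi]_y f y| <=
    C1 * (\sum_(k < n) r ^- (n - k) * (tail P A k x - tail P A k.+1 x)) +
      2 * tail P A n x)%R.
  move=> bf f1; apply: le_trans (dev_le x f bf f1) _; rewrite lerD2r mulr_sumr.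
  by apply: ler_sum => k _; rewrite mulrA ler_wpM2r// subr_ge0 tailS_le.
split=> [lrho|lrho]; apply: (kernel_norm_le chain) => x f bf f1;
  apply: le_trans (dev_r x f bf f1) _.
  apply: (deviation_bound_neq (t := tail P A ^~ x) (D := D)) => //.
  - by move=> k; exact: tail_ge0.
  - by move: lrho; rewrite rhoE eqe eq_sym.
apply: (deviation_bound_eq (t := tail P A ^~ x) (D := D) (l := lambda)) => //.
- by move=> k; exact: tail_ge0.
- by rewrite /r -lrho.
Qed.
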